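(* Let $n\ge1$, $1\le M\le n$, and let $\underline{s}\in\mathbb{R}^n$ with $s_i>\frac12$ for $i\neq M$ and $s_M>0$. The inverse mean map $\psi^{(M)}_{\underline{s}}:Q_G\to P_G$ of the Wishart family $(\gamma^{(M)}_{\underline{s},y})_{y\in P_G}$ is given by $$\psi^{(M)}_{\underline{s}}(m)=\mathrm{grad}_m\log\delta^{(M)}_{\underline{s}}(m),\qquad m\in Q_G.$$
   Context: $G=A_n$ is the path graph $1-2-\cdots-n$ on $V=\{1,\dots,n\}$; $E=\{(i,j): |i-j|\le 1\}$. $Z_G$ is the space of real symmetric $n\times n$ matrices $y$ with $y_{ij}=0$ if $(i,j)\notin E$; $P_G$ is the set of positive definite $y\in Z_G$. $I_G$ is the dual space of $Z_G$, realised as the space of incomplete symmetric matrices $\eta=(\eta_{ij})_{(i,j)\in E}$, with $\langle y,\eta\rangle=\mathrm{tr}(y\eta)=\sum_{(i,j)\in E}y_{ij}\eta_{ij}$. $Q_G=\{\eta\in I_G:\langle y,\eta\rangle>0\ \forall y\in\overline{P_G}\setminus\{0\}\}$. $d\eta$ is Lebesgue measure on $I_G$. For $I\subset V$, $\eta_I$ is the submatrix with rows and columns in $I$; $\{i:j\}=\{i,\dots,j\}$; $|\cdot|$ is the determinant. With the convention $s_0=s_{n+1}=0$, for $\eta\in Q_G$, $$\delta^{(M)}_{\underline{s}}(\eta)=\frac{\prod_{i=1}^{M-1}|\eta_{\{i:i+1\}}|^{s_i}\prod_{i=M+1}^{n}|\eta_{\{i-1:i\}}|^{s_i}}{\prod_{i=2}^{M-1}\eta_{ii}^{s_{i-1}}\cdot\eta_{MM}^{s_{M-1}-s_M+s_{M+1}}\cdot\prod_{i=M+1}^{n-1}\eta_{ii}^{s_{i+1}}}.$$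 $\varphi_{A_1}(\eta)=\eta^{-1}$, and for $n\ge2$, $\varphi_{A_n}(\eta)=\prod_{i=1}^{n-1}|\eta_{\{i,i+1\}}|^{-3/2}\prod_{i=2}^{n-1}\eta_{ii}$. For $y\in P_G$, the Wishart distribution $\gamma^{(M)}_{\underline{s},y}$ on $Q_G$ is the probability measure with density proportional to $e^{-\mathrm{tr}(y\eta)}\delta^{(M)}_{\underline{s}}(\eta)\varphi_{A_n}(\eta)$ with respect to $d\eta$ on $Q_G$. Its mean function is $m^{(M)}_{\underline{s}}(y)=\int_{Q_G}\eta\,\gamma^{(M)}_{\underline{s},y}(d\eta)$; $m^{(M)}_{\underline{s}}:P_G\to Q_G$ is a diffeomorphism and the inverse mean map $\psi^{(M)}_{\underline{s}}:Q_G\to P_G$ is its inverse. The gradient of a function $F$ on $Q_G$ at $m$ is the element $\mathrm{grad}_mF(m)\in Z_G$ such that the directional derivative of $F$ at $m$ along $h\in I_G$ equals $\langle\mathrm{grad}_mF(m),h\rangle$. *)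

(* Defs.v *)
From HB Require Import structures.
From mathcomp Require Import all_boot all_order all_algebra.
From mathcomp Require Import all_classical all_reals all_analysis.
Import Order.TTheory GRing.Theory Num.Theory.
Import numFieldNormedType.Exports.

Set Implicit Arguments.
Unset Strict Implicit.
Unset Printing Implicit Defensive.

Local Open Scope classical_set_scope.
Local Open Scope ring_scope.

Definition measure_matrix_display : measure_display -> measure_display.
Proof. exact. Qed.

(* Matrices carry the sigma-algebra generated by their entries. *)
Section measurable_matrix.
Context {d} {T : sigmaRingType d}.
Variables m n : nat.

Definition mx_cylinder : set (set 'M[T]_(m, n)) :=
  [set A | exists i j, exists2 B, measurable B &
     A = (fun M : 'M[T]_(m, n) => M i j) @^-1` B].

Let mx0 : <<s mx_cylinder >> set0.
Proof. exact: sigma_algebra0. Qed.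

Let mxC A : <<s mx_cylinder >> A -> <<s mx_cylinder >> (~` A).
Proof. exact: sigma_algebraC. Qed.

Let mx_bigcup (F : _^nat) : (forall i, <<s mx_cylinder >> (F i)) ->
  <<s mx_cylinder >> (\bigcup_i (F i)).
Proof. exact: sigma_algebra_bigcup. Qed.

HB.instance Definition _ := @isMeasurable.Build (measure_matrix_display d)
  'M[T]_(m, n) <<s mx_cylinder >> mx0 mxC mx_bigcup.

End measurable_matrix.

Lemma measurable_mx_entry d (T : sigmaRingType d) m n (i : 'I_m) (j : 'I_n) :
  measurable_fun [set: 'M[T]_(m, n)] (fun M : 'M[T]_(m, n) => M i j).
Proof.
by move=> _ B mB; rewrite setTI; apply: sub_sigma_algebra; exists i, j, B.
Qed.

Lemma measurable_fun_mxP d1 d2 (T1 : measurableType d1) (T2 : measurableType d2)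
    m n (f : T1 -> 'M[T2]_(m, n)) :
  (forall i j, measurable_fun [set: T1] (fun x => f x i j)) ->
  measurable_fun [set: T1] f.
Proof.
move=> mf; apply: (measurability (@mx_cylinder _ T2 m n)) => //.
by move=> _ [_ [i [j [B mB ->]]] <-]; exact: mf.
Qed.

Section lebesgue_tuple.
Variable R : realType.
Local Notation RT := (measurableTypeR R).

Definition cons_pair k (p : RT * k.-tuple RT) : k.+1.-tuple RT :=
  [tuple of p.1 :: p.2].

Lemma measurable_cons_pair k : measurable_fun setT (@cons_pair k).
Proof.
exact: (@measurable_cons _ _ (RT * k.-tuple RT)%type RT fst k snd).
Qed.

Section step.
Variables (k : nat) (mu : {sigma_finite_measure set (k.-tuple RT) -> \bar R}).

Definition lebesgue_cons : set (k.+1.-tuple RT) -> \bar R :=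
  pushforward (@lebesgue_measure R \x mu)%E (@cons_pair k).

Let lc0 : lebesgue_cons set0 = 0%E.
Proof. by rewrite /lebesgue_cons /pushforward preimage_set0 measure0. Qed.

Let lc_ge0 A : (0 <= lebesgue_cons A)%E.
Proof. by rewrite /lebesgue_cons /pushforward; exact: measure_ge0. Qed.

Let lc_sigma_additive : semi_sigma_additive lebesgue_cons.
Proof.
move=> F mF tF mUF; rewrite /lebesgue_cons /pushforward preimage_bigcup.
have mc := @measurable_cons_pair k.
apply: measure_semi_sigma_additive.
- by move=> i; rewrite -[X in measurable X]setTI; exact: mc.
- apply/trivIsetP => /= i j _ _ ij; rewrite -preimage_setI.
  by move/trivIsetP : tF => /(_ _ _ _ _ ij) ->//; rewrite preimage_set0.
- by rewrite -preimage_bigcup -[X in measurable X]setTI; exact: mc.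
Qed.

HB.instance Definition _ := isMeasure.Build _ _ _ lebesgue_cons
  lc0 lc_ge0 lc_sigma_additive.

Let lc_sigma_finite : sigma_finite setT lebesgue_cons.
Proof.
have /sigma_finiteP[F [TF ndF Foo]] := sigma_finiteT (@lebesgue_measure R).
have /sigma_finiteP[G [TG ndG Goo]] := sigma_finiteT mu.
pose uncons (t : k.+1.-tuple RT) : RT * k.-tuple RT :=
  (tnth t ord0, [tuple of behead t]).
have unconsK : uncons \o @cons_pair k = id.
  apply/funext => -[x t] /=; rewrite /uncons /cons_pair /= tnth0.
  by congr pair; exact: val_inj.
have muncons : measurable_fun setT uncons.
  apply/measurable_fun_pairP; split; first exact: measurable_tnth.
  exact: measurable_behead.
exists (fun i => uncons @^-1` (F i `*` G i)).
  rewrite -preimage_bigcup (_ : \bigcup_i _ = setT) ?preimage_setT//.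
  rewrite -subTset => -[x t] _.
  have [i _ Fx] : (\bigcup_i F i) x by rewrite -TF.
  have [j _ Gt] : (\bigcup_i G i) t by rewrite -TG.
  exists (maxn i j) => //; split.
    by move: x Fx; exact/subsetPset/ndF/leq_maxl.
  by move: t Gt; exact/subsetPset/ndG/leq_maxr.
move=> i; have [mF Fioo] := Foo i; have [mG Gioo] := Goo i; split.
  by rewrite -[X in measurable X]setTI; apply: muncons => //; exact: measurableX.
rewrite /lebesgue_cons /pushforward -comp_preimage unconsK.
by rewrite product_measure1E// lte_mul_pinfty// ge0_fin_numE.
Qed.

HB.instance Definition _ := Measure_isSigmaFinite.Build _ _ _ lebesgue_cons
  lc_sigma_finite.

End step.

(* Lebesgue measure on R^k, as an iterated product measure. *)
Fixpoint lebesgue_tuple (k : nat) :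
    {sigma_finite_measure set (k.-tuple RT) -> \bar R} :=
  match k with
  | 0 => \d_[tuple]
  | k'.+1 => lebesgue_cons (lebesgue_tuple k')
  end.

End lebesgue_tuple.

Section path_graph.
Variables (R : realType) (n : nat).
Implicit Types (y eta m h g : 'M[R]_n) (s : 'rV[R]_n) (i j k M : nat).

Definition edge : rel 'I_n := fun a b => (a <= b.+1)%N && (b <= a.+1)%N.

Definition ZG : set 'M[R]_n :=
  [set y | y^T = y /\ forall a b, ~~ edge a b -> y a b = 0].

Definition PG : set 'M[R]_n :=
  [set y | ZG y /\ forall x : 'cV[R]_n, x != 0 -> 0 < (x^T *m y *m x) 0 0].

(* An incomplete symmetric matrix is stored as the symmetric matrix whose
   entries outside the edge set are 0. As they meet only zero entries of
   y \in ZG, \tr (y *m eta) is the sum of y_ij * eta_ij over the edges. *)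
Definition IG : set 'M[R]_n :=
  [set eta | eta^T = eta /\ forall a b, ~~ edge a b -> eta a b = 0].

Definition pairing y eta : R := \tr (y *m eta).

Definition QG : set 'M[R]_n :=
  [set eta | IG eta /\ forall y, closure PG y -> y != 0 -> 0 < pairing y eta].

(* Indices of s and of matrix entries below run from 1 to n; outside of this
   range the value is 0, whence s_0 = s_{n+1} = 0. *)
Definition index1 k : option 'I_n := if k is k'.+1 then insub k' else None.

Definition coef s k : R := if index1 k is Some a then s 0 a else 0.

Definition entry eta i j : R :=
  match index1 i, index1 j with
  | Some a, Some b => eta a b
  | _, _ => 0
  end.

(* The determinant of the submatrix with rows and columns {i, i+1}. *)
Definition det2 eta i : R :=
  \det (\matrix_(a < 2, b < 2) entry eta (i + a) (i + b)).

Definition delta M s eta : R :=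
  (\prod_(1 <= i < M) det2 eta i `^ coef s i *
   \prod_(M.+1 <= i < n.+1) det2 eta i.-1 `^ coef s i) /
  (\prod_(2 <= i < M) entry eta i i `^ coef s i.-1 *
   entry eta M M `^ (coef s M.-1 - coef s M + coef s M.+1) *
   \prod_(M.+1 <= i < n) entry eta i i `^ coef s i.+1).

Definition phi eta : R :=
  if n == 1%N then (entry eta 1 1)^-1
  else \prod_(1 <= i < n) det2 eta i `^ (- (3 / 2)) *
       \prod_(2 <= i < n) entry eta i i.

(* The coordinates on IG are the diagonal and the superdiagonal. *)
Definition IG_chart
    (p : n.-tuple (measurableTypeR R) * n.-1.-tuple (measurableTypeR R)) :
    'M[R]_n :=
  \matrix_(a, b) if a == b then tnth p.1 a
                 else if edge a b then nth 0 p.2 (minn a b) else 0.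

Lemma measurable_IG_chart : measurable_fun setT IG_chart.
Proof.
apply: measurable_fun_mxP => a b.
have [<-|ab] := eqVneq a b.
  rewrite (_ : (fun _ => _) = (fun t => tnth t a) \o fst); last first.
    by apply/funext => p /=; rewrite mxE eqxx.
  by apply: measurableT_comp => //; exact: measurable_tnth.
have [eab|neab] := boolP (edge a b); last first.
  rewrite (_ : (fun _ => _) = cst 0)//.
  by apply/funext => p /=; rewrite mxE (negbTE ab) (negbTE neab).
have [lt_ab|le_ab] := ltnP (minn a b) n.-1; last first.
  rewrite (_ : (fun _ => _) = cst 0)//.
  apply/funext => p /=; rewrite mxE (negbTE ab) eab nth_default//.
  by rewrite size_tuple.
rewrite (_ : (fun _ => _) = (fun t => tnth t (Ordinal lt_ab)) \o snd); last first.
  apply/funext => p /=; rewrite mxE (negbTE ab) eab (tnth_nth 0)//=.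
by apply: measurableT_comp => //; exact: measurable_tnth.
Qed.

Definition lebesgue_IG : set 'M[R]_n -> \bar R :=
  pushforward (lebesgue_tuple R n \x lebesgue_tuple R n.-1)%E IG_chart.

Let leb0 : lebesgue_IG set0 = 0%E.
Proof. by rewrite /lebesgue_IG /pushforward preimage_set0 measure0. Qed.

Let leb_ge0 A : (0 <= lebesgue_IG A)%E.
Proof. by rewrite /lebesgue_IG /pushforward; exact: measure_ge0. Qed.

Let leb_sigma_additive : semi_sigma_additive lebesgue_IG.
Proof.
move=> F mF tF mUF; rewrite /lebesgue_IG /pushforward preimage_bigcup.
have mc := measurable_IG_chart.
apply: measure_semi_sigma_additive.
- by move=> i; rewrite -[X in measurable X]setTI; exact: mc.
- apply/trivIsetP => /= i j _ _ ij; rewrite -preimage_setI.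
  by move/trivIsetP : tF => /(_ _ _ _ _ ij) ->//; rewrite preimage_set0.
- by rewrite -preimage_bigcup -[X in measurable X]setTI; exact: mc.
Qed.

HB.instance Definition _ := isMeasure.Build _ _ _ lebesgue_IG
  leb0 leb_ge0 leb_sigma_additive.

Definition is_wishart M s y (P : probability 'M[R]_n R) : Prop :=
  exists c : R, forall A, measurable A ->
    P A = (\int[lebesgue_IG]_(eta in A `&` QG)
             (c * (expR (- pairing y eta) * delta M s eta * phi eta))%:E)%E.

(* The probability measure on QG with the above density; an arbitrary one if
   that density cannot be normalised. *)
Definition wishart M s y : probability 'M[R]_n R :=
  get [set P : pprobability 'M[R]_n R | is_wishart M s y P].

Definition mean_map M s y : 'M[R]_n :=
  \matrix_(a, b) (\int[wishart M s y]_(eta in QG) eta a b)%R.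

Definition inverse_mean_map M s : 'M[R]_n -> 'M[R]_n :=
  'pinv_(fun=> 0) PG (mean_map M s).

Definition is_gradient (F : 'M[R]_n -> R) m g : Prop :=
  ZG g /\ forall h, IG h -> is_derive m h F (pairing g h).

End path_graph.

(* Main.v *)
From HB Require Import structures.
Require Import Defs.
From mathcomp Require Import all_boot all_order all_algebra.
From mathcomp Require Import all_classical all_reals all_analysis.
From mathcomp Require Import measurable_realfun ring lra zify.
Import Order.TTheory GRing.Theory Num.Theory.
Import numFieldNormedType.Exports.

(** Root the path at the vertex [r] of index [M], so that every other vertex
    [i] has a parent [p i], its neighbour on the side of [r].  The proof is
    carried out in coordinates adapted to this rooted tree.

    Put [v i = e_i - t i * e_(p i)], with [t r = 0].  Eliminating the vertices
    from the leaves to the root creates no new entries, so every [y] in [PG] is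
    uniquely [\sum_i D i *: (v i *m (v i)^T)] with [D i > 0] ([coordmx],
    [PG_coordmx]).  On the dual side, [eta] is described by its slopes
    [eta i (p i) / eta (p i) (p i)] and by the pivots
    [eta i i - eta i (p i) ^+ 2 / eta (p i) (p i)]; being in [QG] means that all
    pivots are positive ([QG_pivotal]).  The two systems of coordinates are
    related by
      [pairing y eta = \sum_i D i * (pivot i + (t i - slope i) ^+ 2 * eta (p i) (p i))],
    and [delta] is the product of the [pivot i `^ s i] ([delta_pivot]).

    Hence the unnormalised density is a product of one factor for each edge,
    which, the entry of the parent being fixed, is Gaussian in the slope and a
    gamma density in the pivot.  Integrating the vertices out one after the
    other, from the two ends of the path towards the root, gives the total mass
    [C * \prod_i D i `^ (- s i)], where [C] depends neither on [D] nor on [t]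
    ([integral_weight]).

    The mean [m] is read off from this formula without differentiating an
    integral.  As [exp x >= 1 + x], for every other parameter [y'] the number
    [1 + pairing y m - pairing y' m] is at most the ratio of the total masses
    at [y'] and at [y] ([mean_tangent]), with equality at [y' = y].  Varying one
    [D i] yields [D i * form i = s i], where [form i] is the quadratic form of
    [m] at [v i] ([mean_form]); varying one [t i], which leaves the total mass
    unchanged, yields that [m] has slope [t i] ([mean_slope]).  In coordinates
    the mean map is thus [(D, t) |-> (pivot = s / D, slope = t)]
    ([mean_coordinates]), which is visibly a bijection, with inverse
    [m |-> \sum_i (s i / pivot m i) *: (v i *m (v i)^T)], the [v i] being taken
    at the slopes of [m] ([parameter_of_mean]).

    Finally, a pivot is the minimum over [t i] of the quadratic form at [v i],
    so its derivative at [m] along [h] is the form of [h] at the minimiser, that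
    is, the pairing of [h] with [v i *m (v i)^T] ([is_derive_pivot]).
    Differentiating [\sum_i s i * ln (pivot i)] therefore gives the same matrix
    ([gradient_ln_delta]). *)

Set Implicit Arguments.
Unset Strict Implicit.
Unset Printing Implicit Defensive.

Local Open Scope classical_set_scope.
Local Open Scope ring_scope.

(** * One-dimensional integrals *)

Section affine_substitution.
Variable R : realType.
Local Notation mu := (@lebesgue_measure R).
Local Notation RT := (measurableTypeR R).

Let affine (a b : R) : RT -> RT := fun x => a * x + b.

Let measurable_affine a b : measurable_fun setT (affine a b).
Proof. by apply: measurable_funD => //; exact: measurable_funM. Qed.

(** Lebesgue measure is determined by its values on half-open intervals, and
    an affine map of slope [a] divides their lengths by [a]. *)
Lemma ge0_integral_affine (a b : R) (f : RT -> \bar R) : 0 < a ->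
  measurable_fun setT f -> (forall x, 0 <= f x)%E ->
  (\int[mu]_x f x = a%:E * \int[mu]_x f (a * x + b)%R)%E.
Proof.
move=> a0 mf f0.
have ma := measurable_affine a b.
pose nu : measure RT R := mscale (NngNum (ltW a0)) (pushforward mu (affine a b)).
rewrite (eq_measure_integral (nu ma)); last first.
  move=> A mA _; apply: lebesgue_measure_unique => //= _ [[u v] _ <-] /=.
  rewrite /mscale /= /pushforward.
  have -> : affine a b @^-1` [set` `]u, v]%R] =
      [set` `](u - b) / a, (v - b) / a]%R].
    apply/seteqP; split=> x /=; rewrite !in_itv/= /affine.
      by rewrite ltr_pdivrMr// ler_pdivlMr// ltrBlDr lerBrDr mulrC.
    by rewrite ltr_pdivrMr// ler_pdivlMr// ltrBlDr lerBrDr mulrC.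
  rewrite !lebesgue_measure_itv /= !lte_fin ltr_pM2r ?invr_gt0//.
  rewrite ltrD2r; case: ifPn => uv; last by rewrite mule0.
  by rewrite -!EFinD -EFinM; congr EFin; field; rewrite gt_eqF.
rewrite ge0_integral_mscale//.
by rewrite (ge0_integral_pushforward ma) //.
Qed.

End affine_substitution.

Section gamma_integral.
Variable R : realType.
Local Notation mu := (@lebesgue_measure R).
Local Notation RT := (measurableTypeR R).

Definition gamma_density (p D : R) (x : RT) : R :=
  if 0 < x then x `^ p * expR (- (D * x)) else 0.

Lemma gamma_density_ge0 p D x : 0 <= gamma_density p D x.
Proof.
by rewrite /gamma_density; case: ifP => // _; rewrite mulr_ge0 ?powR_ge0 ?expR_ge0.
Qed.

Lemma measurable_gamma_density p D : measurable_fun setT (gamma_density p D).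
Proof.
apply: measurable_fun_ifT => //.
- exact: measurable_fun_ltr.
- apply: measurable_funM => //.
  apply: measurableT_comp => //; apply: measurableT_comp => //.
Qed.

Definition gamma_integral p D : \bar R := (\int[mu]_x (gamma_density p D x)%:E)%E.

Lemma gamma_integral_scale p D : 0 < D ->
  gamma_integral p D = ((D `^ (- (p + 1)))%:E * gamma_integral p 1)%E.
Proof.
move=> D0; rewrite /gamma_integral.
have mg q : measurable_fun setT (EFin \o gamma_density q 1).
  by apply/measurable_EFinP; exact: measurable_gamma_density.
have mgD : measurable_fun setT (EFin \o gamma_density p D).
  by apply/measurable_EFinP; exact: measurable_gamma_density.
have Dinv0 : 0 < D^-1 by rewrite invr_gt0.
rewrite (ge0_integral_affine 0 Dinv0 mgD); last first.
  by move=> x; rewrite lee_fin gamma_density_ge0.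
have -> : D `^ (- (p + 1)) = D^-1 * D `^ (- p).
  have -> : - (p + 1) = -1 + - p by ring.
  rewrite powRD; last by rewrite (gt_eqF D0) implybT.
  by rewrite powR_inv1// ltW.
rewrite EFinM -muleA; congr (_ * _)%E.
rewrite -ge0_integralZl// ?lee_fin ?powR_ge0//; last 2 first.
- exact: mg.
- by move=> x _; rewrite lee_fin gamma_density_ge0.
apply: eq_integral => x _; rewrite -EFinM; congr EFin.
rewrite /gamma_density addr0 pmulr_rgt0 ?invr_gt0//.
case: ifP => x0; last by rewrite mulr0.
rewrite powRM ?invr_ge0 ?ltW// mulrA -powR_inv1 ?ltW// -powRrM mulN1r.
by rewrite powR_inv1 ?ltW// mul1r mulrA mulfV ?gt_eqF// mul1r.
Qed.

(** The function [x ^ (p + 1) / (p + 1)] is a bounded primitive of [x ^ p]. *)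
Lemma integral_powR_near0_lty (p : R) : -1 < p ->
  (\int[mu]_(x in `]0%R, 1%R]) (x `^ p)%:E < +oo)%E.
Proof.
move=> p1; have q0 : 0 < p + 1 by rewrite -ltrBlDr sub0r.
pose F (k : nat) : set RT := [set` `[(k.+2%:R^-1 : R), 1]%R].
have FE : `]0%R, 1%R]%classic = \bigcup_k F k.
  apply/seteqP; split=> x /=.
    rewrite in_itv/= => /andP[x0 x1].
    have [k kx] := ltr_add_invr x0; rewrite add0r in kx.
    exists k => //; rewrite /F /= in_itv/= x1 andbT (le_trans _ (ltW kx))//.
    by rewrite lef_pV2 ?posrE// ler_nat.
  move=> [k _]; rewrite /F /= !in_itv/= => /andP[kx ->]; rewrite andbT.
  exact: lt_le_trans kx.
have powR_cont (q x : R) : 0 < x -> {for x, continuous (@powR R ^~ q)}.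
  move=> x0; apply: differentiable_continuous; apply/derivable1_diffP.
  by have [] := is_derive1_powR q x0.
have Fint k : (\int[mu]_(x in F k) (x `^ p)%:E <= ((p + 1)^-1)%:E)%E.
  have k0 : 0 < k.+2%:R^-1 :> R by rewrite invr_gt0.
  have k1 : k.+2%:R^-1 < 1 :> R by rewrite invf_lt1// ltr1n.
  rewrite (@continuous_FTC2 _ _ (fun x => (p + 1)^-1 * x `^ (p + 1)))//.
  - rewrite -EFinB lee_fin powR1 mulr1 gerBl mulr_ge0 ?powR_ge0//.
    by rewrite invr_ge0 ltW.
  - apply: continuous_in_subspaceT => x; rewrite inE/= in_itv/= => /andP[kx _].
    by apply: powR_cont; exact: lt_le_trans kx.
  - split=> [x|/=|/=].
    + rewrite in_itv/= => /andP[kx _].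
      apply: derivableM => //.
      by have [] := is_derive1_powR (p + 1) (lt_trans k0 kx).
    + apply: cvgMr; apply: cvg_at_right_filter; exact: powR_cont.
    + apply: cvgMr; apply: cvg_at_left_filter; exact: powR_cont.
  - move=> x; rewrite in_itv/= => /andP[kx _].
    have x0 := lt_trans k0 kx.
    have := is_derive1_powR (p + 1) x0 => dp.
    rewrite derive1E derive_val.
    by rewrite addrK /GRing.scale/= mulrA mulVf ?gt_eqF// mul1r.
rewrite FE; apply: (@le_lt_trans _ _ ((p + 1)^-1)%:E); last exact: ltry.
have mp D : measurable_fun D (fun x : RT => (x `^ p)%:E).
  by apply: measurable_funTS; apply/measurable_EFinP.
have Fcvg : (\int[mu]_(x in F k) (x `^ p)%:E)%E @[k --> \oo] -->
    (\int[mu]_(x in \bigcup_k F k) (x `^ p)%:E)%E.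
  apply: ge0_nondecreasing_set_cvg_integral => //.
  - move=> k l kl; apply/subsetPset => x; rewrite /F /= !in_itv/= => /andP[kx ->].
    by rewrite andbT (le_trans _ kx)// lef_pV2 ?posrE// ler_nat !ltnS.
  - by move=> k; exact: measurable_itv.
  - by move=> k x _; rewrite lee_fin powR_ge0.
rewrite -(cvg_lim _ Fcvg)//; apply: lime_le; last exact: nearW.
by apply/cvg_ex; eexists; exact: Fcvg.
Qed.

(** Near the origin the exponential is harmless; beyond [1] a logarithm grows
    slower than any linear function, so half of the exponential decay absorbs
    the power. *)
Lemma gamma_integral_lty p : -1 < p -> (gamma_integral p 1 < +oo)%E.
Proof.
move=> p1.
(* [ln x <= c * x - ln c] for every positive [c]; this one has [`|p| * c <= 1 / 2]. *)
pose c : R := (2 * (`|p| + 1))^-1.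
have c0 : 0 < c by rewrite invr_gt0 mulr_gt0// ltr_wpDl.
pose C : R := expR (`|p| * `|ln c|).
have tail (x : R) : 0 < x -> 1 < x -> x `^ p * expR (- x) <= C * expR (- (x / 2)).
  move=> x0 x1; rewrite /powR gt_eqF// -!expRD ler_expR.
  have lnx : ln x <= c * x - ln c.
    by rewrite lerBrDl -lnM ?posrE// ltW// ln_sublinear// mulr_gt0.
  have lnx0 : 0 <= ln x by rewrite ln_ge0// ltW.
  have h1 : p * ln x <= `|p| * ln x by rewrite ler_wpM2r// ler_norm.
  have h2 : `|p| * ln x <= `|p| * (c * x + `|ln c|).
    rewrite ler_wpM2l// (le_trans lnx)// lerD2l -normrN; exact: ler_norm.
  have h3 : `|p| * (c * x) <= x / 2.
    rewrite mulrA mulrC ler_wpM2l ?(ltW x0)// /c invfM mulrCA.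
    rewrite ler_piMr// ?invr_ge0// ler_pdivrMr ?mul1r ?lerDl//.
  by move: h1 h2 h3; rewrite mulrDr; lra.
pose h : RT -> \bar R := (fun x => (x `^ p)%:E) \_ `]0%R, 1%R].
pose k (x : RT) : \bar R := ((2 * C)%:E * (exponential_pdf 2^-1 x)%:E)%E.
have h0 x : (0 <= h x)%E.
  by rewrite /h patchE; case: ifP => //; rewrite lee_fin powR_ge0.
have half0 : 0 < 2^-1 :> R by rewrite invr_gt0.
have C20 : 0 <= 2 * C by rewrite mulr_ge0// expR_ge0.
have k0 x : (0 <= k x)%E.
  by rewrite mule_ge0// lee_fin// exponential_pdf_ge0// ltW.
have mh : measurable_fun setT h.
  have m01 : measurable (`]0%R, 1%R]%classic : set RT) by exact: measurable_itv.
  apply: (measurable_restrictT (fun x : RT => (x `^ p)%:E) m01).1.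
  by apply: measurable_funTS; apply/measurable_EFinP.
have mexp : measurable_fun setT (fun x : RT => (exponential_pdf 2^-1 x)%:E).
  by apply/measurable_EFinP; exact: measurable_exponential_pdf.
have mk : measurable_fun setT k by exact: measurable_funeM.
apply: (@le_lt_trans _ _ (\int[mu]_x (h x + k x))%E).
  apply: ge0_le_integral => //.
  - by move=> x _; rewrite lee_fin gamma_density_ge0.
  - by apply/measurable_EFinP; exact: measurable_gamma_density.
  - exact: emeasurable_funD.
  - move=> x _; rewrite /gamma_density; case: ifPn => x0; last by rewrite adde_ge0.
    rewrite mul1r; have [x1|x1] := leP x 1.
      rewrite -[leLHS]adde0 leeD// /h patchE mem_set/= ?in_itv/= ?x0//.
      by rewrite lee_fin ler_piMr ?powR_ge0// expR_le1 oppr_le0 ltW.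
    rewrite -[leLHS]add0e leeD// /k -EFinM lee_fin (le_trans (tail _ x0 x1))//.
    rewrite /exponential_pdf patchE mem_set/= ?in_itv/= ?(ltW x0)//.
    rewrite le_eqVlt; apply/orP; left; apply/eqP.
    by rewrite (_ : - 2^-1 * x = - (x / 2)); field.
rewrite ge0_integralD// lte_add_pinfty//.
  by rewrite /h -integral_mkcond; exact: integral_powR_near0_lty.
rewrite ge0_integralZl//; last by move=> x _; rewrite lee_fin exponential_pdf_ge0// ltW.
by rewrite integral_exponential_pdf// mule1 ltry.
Qed.

Lemma gamma_integral_gt0 p : (0 < gamma_integral p 1)%E.
Proof.
(* A lower bound of the integrand on [1, 2]. *)
pose m : R := expR (- (`|p| * ln 2 + 2)).
apply: (@lt_le_trans _ _ (\int[mu]_(x in `[1%R, 2%R]) m%:E)%E).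
  rewrite integral_cst//= lebesgue_measure_itv/= lte_fin ltr1n -EFinB -EFinM.
  by rewrite lte_fin mulr_gt0 ?expR_gt0//; lra.
rewrite /gamma_integral.
apply: (@le_trans _ _ (\int[mu]_(x in `[1%R, 2%R]) (gamma_density p 1 x)%:E)%E).
  apply: ge0_le_integral => //.
  - by move=> x _; rewrite lee_fin expR_ge0.
  - apply: measurable_funTS; apply/measurable_EFinP.
    exact: measurable_gamma_density.
  - move=> x /=; rewrite in_itv/= => /andP[x1 x2].
    have x0 : 0 < x by exact: lt_le_trans x1.
    rewrite lee_fin /gamma_density x0 mul1r /powR gt_eqF// -expRD ler_expR.
    have l0 : 0 <= ln x by exact: ln_ge0.
    have l2 : ln x <= ln 2 by rewrite ler_ln ?posrE.
    have h1 : - p * ln x <= `|p| * ln x by rewrite ler_wpM2r// -normrN ler_norm.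
    have h2 : `|p| * ln x <= `|p| * ln 2 by rewrite ler_wpM2l.
    by move: h1 h2; rewrite mulNr; lra.
apply: ge0_subset_integral => //.
- by apply/measurable_EFinP; exact: measurable_gamma_density.
- by move=> x _; rewrite lee_fin gamma_density_ge0.
Qed.

End gamma_integral.

Section gaussian_integral.
Variable R : realType.
Local Notation mu := (@lebesgue_measure R).
Local Notation RT := (measurableTypeR R).

Lemma integral_gaussian (c m : R) : 0 < c ->
  (\int[mu]_x (expR (- (c * (x - m) ^+ 2)))%:E = (Num.sqrt (pi / c))%:E)%E.
Proof.
move=> c0; pose sigma : R := Num.sqrt (2 * c)^-1.
have sigma0 : 0 < sigma by rewrite sqrtr_gt0 invr_gt0 mulr_gt0.
have sigma2 : sigma ^+ 2 *+ 2 = c^-1.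
  rewrite sqr_sqrtr ?invr_ge0 ?mulr_ge0 ?(ltW c0)// -mulr_natr.
  by rewrite invfM mulrAC mulVf// mul1r.
have pic0 : 0 < Num.sqrt (pi / c) by rewrite sqrtr_gt0 divr_gt0// pi_gt0.
have pdfE x : expR (- (c * (x - m) ^+ 2)) =
    Num.sqrt (pi / c) * normal_pdf m sigma x.
  rewrite /normal_pdf gt_eqF// /normal_peak /normal_fun sigma2 invrK.
  rewrite -mulrnAl sigma2 [c^-1 * pi]mulrC.
  by rewrite mulVKf ?gt_eqF// mulNr mulrC.
under eq_integral => x _ do rewrite pdfE EFinM.
have mpdf : measurable_fun setT (fun x : RT => (normal_pdf m sigma x)%:E).
  by apply/measurable_EFinP; exact: measurable_normal_pdf.
rewrite (ge0_integralZl _ measurableT mpdf) => [|x _|]; last 2 first.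
- by rewrite lee_fin normal_pdf_ge0.
- by rewrite lee_fin ltW.
by rewrite integral_normal_pdf mule1.
Qed.

End gaussian_integral.

Section edge_kernel.
Variable R : realType.
Local Notation mu := (@lebesgue_measure R).
Local Notation RT := (measurableTypeR R).

Lemma measurable_inv : measurable_fun [set: RT] (fun x : RT => x^-1 : RT).
Proof.
(* The real power of a square is measurable; at [0] both sides vanish. *)
rewrite (_ : (fun _ => _) = (fun x : RT => x * (x ^+ 2) `^ (-1))).
  apply: measurable_funM => //.
  by apply: (measurableT_comp (measurable_powR _)).
apply/funext => x; have [->|x0] := eqVneq x 0; first by rewrite invr0 mul0r.
by rewrite powR_inv1 ?sqr_ge0// expr2 invfM mulrA mulfV// mul1r.
Qed.

(** The part of the unnormalised density that belongs to an edge: [a] and [x]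
    are the diagonal entries of the child and of the parent, and [b] is the entry
    of the edge, so that the pivot is [a - b ^+ 2 / x] and the slope [b / x]. *)
Definition edge_kernel (p D t : R) (a b x : RT) : R :=
  if 0 < x then gamma_density p D (a - b ^+ 2 / x) *
                expR (- (D / x * (b - t * x) ^+ 2)) * x `^ (- 2^-1)
  else 0.

Lemma edge_kernel_ge0 p D t a b x : 0 <= edge_kernel p D t a b x.
Proof.
rewrite /edge_kernel; case: ifP => // _.
by rewrite !mulr_ge0 ?gamma_density_ge0 ?expR_ge0 ?powR_ge0.
Qed.

Lemma measurable_edge_kernel d (T : measurableType d) p D t (a b x : T -> RT) :
  measurable_fun setT a -> measurable_fun setT b -> measurable_fun setT x ->
  measurable_fun setT (fun w => edge_kernel p D t (a w) (b w) (x w)).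
Proof.
move=> ma mb mx.
have mxV : measurable_fun setT (fun w => (x w)^-1 : RT).
  exact: (measurableT_comp measurable_inv).
apply: measurable_fun_ifT => //; first exact: measurable_fun_ltr.
apply: measurable_funM; last exact: (measurableT_comp (measurable_powR _)).
apply: measurable_funM.
  apply: (measurableT_comp (measurable_gamma_density _ _)).
  apply: measurable_funB => //; apply: measurable_funM => //.
  exact: measurable_funX.
apply: measurableT_comp => //; apply: measurableT_comp => //.
apply: measurable_funM; first exact: measurable_funM.
apply: measurable_funX; apply: measurable_funB => //.
exact: measurable_funM.
Qed.

(** The substitution [a = u + b ^ 2 / x] separates the kernel into a gamma
    density in [u] and a Gaussian in [b], whose mass [sqrt (pi x / D)] absorbs
    the factor [x ^ (- 1 / 2)]. *)
Lemma integral_edge_kernel (p D t x : R) : 0 < D -> 0 < x ->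
  (\int[mu]_b \int[mu]_a (edge_kernel p D t a b x)%:E =
   (D `^ (- (p + 1 + 2^-1)))%:E * ((Num.sqrt pi)%:E * gamma_integral p 1))%E.
Proof.
move=> D0 x0; rewrite /edge_kernel x0.
pose w b : R := expR (- (D / x * (b - t * x) ^+ 2)) * x `^ (- 2^-1).
have w0 b : 0 <= w b by rewrite mulr_ge0 ?expR_ge0 ?powR_ge0.
have inner b : (\int[mu]_a (gamma_density p D (a - b ^+ 2 / x) *
    expR (- (D / x * (b - t * x) ^+ 2)) * x `^ (- 2^-1))%:E =
    (w b)%:E * gamma_integral p D)%E.
  under eq_integral => a _ do rewrite -mulrA mulrC EFinM.
  have mg : measurable_fun setT (fun a : RT => (gamma_density p D (a - b ^+ 2 / x))%:E).
    apply/measurable_EFinP; apply: (measurableT_comp (measurable_gamma_density _ _)).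
    exact: measurable_funB.
  rewrite (ge0_integralZl _ measurableT mg) => [|a _|]; last 2 first.
  - by rewrite lee_fin gamma_density_ge0.
  - exact: w0.
  rewrite (ge0_integral_affine (b ^+ 2 / x) ltr01 mg); last first.
    by move=> a; rewrite lee_fin gamma_density_ge0.
  rewrite mul1e; congr (_ * _)%E; apply: eq_integral => a _.
  by rewrite mul1r addrK.
under eq_integral => b _ do rewrite inner.
have Dx0 : 0 < D / x by rewrite divr_gt0.
have me : measurable_fun setT (fun b : RT => (expR (- (D / x * (b - t * x) ^+ 2)))%:E).
  apply/measurable_EFinP; apply: measurableT_comp => //; apply: measurableT_comp => //.
  by apply: measurable_funM => //; apply: measurable_funX; exact: measurable_funB.
have gI0 : (0 <= gamma_integral p D)%E.
  by apply: integral_ge0 => a _; rewrite lee_fin gamma_density_ge0.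
have mw : measurable_fun setT (fun b : RT => (w b)%:E).
  by under eq_fun do rewrite EFinM; exact: emeasurable_funM.
rewrite (ge0_integralZr _ measurableT mw) => [|b _|//]; last by rewrite lee_fin.
rewrite /w; under eq_integral => b _ do rewrite EFinM.
rewrite (ge0_integralZr _ measurableT me) => [|b _|]; last 2 first.
- by rewrite lee_fin expR_ge0.
- by rewrite lee_fin powR_ge0.
rewrite integral_gaussian// gamma_integral_scale// muleA -!EFinM [RHS]muleA -EFinM.
congr (_ * _)%E; congr EFin.
have -> : pi / (D / x) = pi * D^-1 * x by field; rewrite !gt_eqF.
rewrite !sqrtrM ?mulr_ge0 ?invr_ge0 ?pi_ge0 ?(ltW D0)//.
rewrite -(powR12_sqrt (ltW x0)) -(powR12_sqrt (_ : 0 <= D^-1)) ?invr_ge0 ?ltW//.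
rewrite -powR_inv1 ?ltW// -powRrM.
have -> : - (p + 1 + 2^-1) = - (p + 1) + (-1 / 2) :> R by field.
rewrite powRD; last by rewrite (gt_eqF D0) implybT.
have xx : x `^ 2^-1 * x `^ (- 2^-1) = 1.
  by rewrite -powRD ?subrr ?powRr0// (gt_eqF x0) implybT.
move: xx; set u := x `^ _; set v := x `^ _; set d := D `^ _.
set e := D `^ _; set q := Num.sqrt _ => uv.
transitivity (q * d * e * (u * v)); first by ring.
by rewrite uv; ring.
Qed.

End edge_kernel.

(** * Iterated integrals along a path *)

Section chain_integral.
Variable R : realType.
Local Notation mu := (@lebesgue_measure R).
Local Notation RT := (measurableTypeR R).
Local Notation tmu := (@lebesgue_tuple R).

Lemma measurable_nth d (T : measurableType d) (k i : nat) (t : T -> k.-tuple RT) :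
  measurable_fun setT t -> measurable_fun setT (fun w => nth 0 (t w) i : RT).
Proof.
move=> mt; have [ik|ik] := ltnP i k.
  rewrite (_ : (fun _ => _) = (fun s : k.-tuple RT => tnth s (Ordinal ik)) \o t).
    by apply: measurableT_comp => //; exact: measurable_tnth.
  by apply/funext => w /=; rewrite (tnth_nth 0).
rewrite (_ : (fun _ => _) = cst 0)//.
by apply/funext => w /=; rewrite nth_default// size_tuple.
Qed.

Lemma integral_lebesgue_tuple0 (f : 0.-tuple RT -> \bar R) :
  (forall t, 0 <= f t)%E -> measurable_fun setT f ->
  (\int[tmu 0]_t f t = f [tuple])%E.
Proof. by move=> f0 mf; rewrite integral_dirac// diracT mul1e. Qed.

Lemma integral_lebesgue_tupleS k (f : k.+1.-tuple RT -> \bar R) :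
  (forall t, 0 <= f t)%E -> measurable_fun setT f ->
  (\int[tmu k.+1]_t f t = \int[mu]_x \int[tmu k]_t f (cons_pair (x, t)))%E.
Proof.
move=> f0 mf; have mc := @measurable_cons_pair R k.
have -> : (\int[tmu k.+1]_t f t =
    \int[pushforward (mu \x tmu k)%E (@cons_pair R k)]_t f t)%E by [].
rewrite (ge0_integral_pushforward mc)//.
rewrite preimage_setT (fubini_tonelli1 (f \o @cons_pair R k))//.
  exact: measurableT_comp.
by move=> ?; exact: f0.
Qed.

Implicit Type K : nat -> RT -> RT -> RT -> R.

(** A product of kernels along a path: [t] lists the values at the vertices, [u]
    those at the edges, and [K i] is the kernel of the edge from [i] to [i.+1]. *)
Definition chain n K (t u : seq RT) : R :=
  \prod_(i < n) K i (nth 0 t i) (nth 0 u i) (nth 0 t i.+1).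

Lemma chain_cons n K a b t u :
  chain n.+1 K (a :: t) (b :: u) =
  K 0%N a b (nth 0 t 0) * chain n (fun i => K i.+1) t u.
Proof. by rewrite /chain big_ord_recl. Qed.

(** Vanishing off the positive vertex values is what permits hypotheses on the
    edge integrals that hold only at a positive value of the fixed vertex. *)
Definition chain_kernel K :=
  [/\ forall i a b x, 0 <= K i a b x,
      forall i, measurable_fun setT
        (fun w : RT * RT * RT => K i w.1.1 w.1.2 w.2 : RT) &
      forall i a b x, ~~ ((0 < a) && (0 < x)) -> K i a b x = 0].

Lemma chain_kernelS K : chain_kernel K -> chain_kernel (fun i => K i.+1).
Proof. by move=> [K0 mK zK]; split => i; [exact: K0|exact: mK|exact: zK]. Qed.

Lemma chain_ge0 n K t u : chain_kernel K -> 0 <= chain n K t u.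
Proof. by move=> [K0 _ _]; apply: prodr_ge0 => i _; exact: K0. Qed.

Lemma measurable_kernel_comp K i d (T : measurableType d) (a b x : T -> RT) :
  chain_kernel K ->
  measurable_fun setT a -> measurable_fun setT b -> measurable_fun setT x ->
  measurable_fun setT (fun w => K i (a w) (b w) (x w) : RT).
Proof.
move=> [_ mK _] ma mb mx; apply: (measurableT_comp (mK i)
  (_ : measurable_fun setT (fun w => (a w, b w, x w)))).
by apply: measurable_fun_pair => //; exact: measurable_fun_pair.
Qed.

Lemma measurable_chain n m K d (T : measurableType d) l
    (t : T -> m.-tuple RT) (u : T -> l.-tuple RT) :
  chain_kernel K -> measurable_fun setT t -> measurable_fun setT u ->
  measurable_fun setT (fun w => chain n K (t w) (u w) : RT).
Proof.
move=> cK mt mu'; apply: measurable_prod => i _.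
have mtn j : measurable_fun setT (fun w => nth 0 (t w) j : RT).
  exact: measurable_nth.
have mun j : measurable_fun setT (fun w => nth 0 (u w) j : RT).
  exact: measurable_nth.
exact: measurable_kernel_comp.
Qed.

Lemma measurable_chain_u n K l (t : seq RT) (G : R) : chain_kernel K ->
  measurable_fun setT (fun u : l.-tuple RT => (chain n K t u * G)%:E).
Proof.
move=> cK; apply/measurable_EFinP; apply: measurable_funM => //.
exact: (@measurable_chain _ (size t) _ _ _ _ (cst (in_tuple t)) id).
Qed.

Lemma measurable_integral2 d d' (T1 : measurableType d) (T2 : measurableType d')
    (m2 : {sigma_finite_measure set T2 -> \bar R}) (f : T1 -> T2 -> \bar R) :
  (forall x y, 0 <= f x y)%E ->
  measurable_fun setT (fun w : T1 * T2 => f w.1 w.2) ->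
  measurable_fun setT (fun x => \int[m2]_y f x y)%E.
Proof.
move=> f0 mf.
by apply: (measurable_fun_fubini_tonelli_F (fun w : T1 * T2 => f w.1 w.2)).
Qed.

Lemma integral_chain_cons n K x (t : seq RT) (G : R) : chain_kernel K -> 0 <= G ->
  (\int[tmu n.+1]_u (chain n.+1 K (x :: t) u * G)%:E =
   (\int[mu]_b (K 0%N x b (nth 0 t 0))%:E) *
   \int[tmu n]_u (chain n (fun i => K i.+1) t u * G)%:E)%E.
Proof.
move=> cK G0; have [K0 mK zK] := cK; have cK' := chain_kernelS cK.
rewrite integral_lebesgue_tupleS; last 2 first.
- by move=> u; rewrite lee_fin mulr_ge0// chain_ge0.
- exact: measurable_chain_u.
have H0 : (0 <= \int[tmu n]_u (chain n (fun i => K i.+1) t u * G)%:E)%E.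
  by apply: integral_ge0 => u _; rewrite lee_fin mulr_ge0// chain_ge0.
have mKb : measurable_fun setT (fun b : RT => (K 0%N x b (nth 0 t 0))%:E).
  by apply/measurable_EFinP; exact: (measurable_kernel_comp 0 cK).
rewrite -(ge0_integralZr _ measurableT mKb) => [|b _|//]; last first.
  by rewrite lee_fin.
apply: eq_integral => b _; have mu' := @measurable_chain_u n _ n t G cK'.
rewrite -(ge0_integralZl _ measurableT mu') => [|u _|]; last 2 first.
- by rewrite lee_fin mulr_ge0// chain_ge0.
- by rewrite lee_fin.
by apply: eq_integral => u _; rewrite chain_cons -mulrA EFinM.
Qed.

(** Right of the root every vertex is integrated before the previous one, and
    each integration contributes the constant of its edge. *)
Lemma integral_chain_right n K (c : nat -> R) (x G : R) : chain_kernel K ->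
  (forall i x, (i < n)%N -> 0 < x ->
     (\int[mu]_a \int[mu]_b (K i x b a)%:E = (c i)%:E)%E) ->
  0 < x -> 0 <= G ->
  (\int[tmu n]_t \int[tmu n]_u (chain n K (x :: t) u * G)%:E =
   (\prod_(i < n) c i * G)%:E)%E.
Proof.
move=> cK Kc x0 G0; elim: n K c x cK Kc x0 => [|n IHn] K c x cK Kc x0.
  have f0 (t : 0.-tuple RT) (u : 0.-tuple RT) : (0 <= (chain 0 K (x :: t) u * G)%:E)%E.
    by rewrite lee_fin mulr_ge0// chain_ge0.
  rewrite (_ : (fun t => _) = cst G%:E); last first.
    apply/funext => t; rewrite integral_lebesgue_tuple0//.
      by rewrite /chain big_ord0 mul1r.
    exact: measurable_chain_u.
  by rewrite integral_lebesgue_tuple0// big_ord0 mul1r.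
have [K0 mK zK] := cK; have cK' := chain_kernelS cK.
have mxt m (K' : nat -> RT -> RT -> RT -> R) d (T : measurableType d) k l
    (x' : T -> RT) (t : T -> k.-tuple RT) (u : T -> l.-tuple RT) :
    chain_kernel K' -> measurable_fun setT x' ->
    measurable_fun setT t -> measurable_fun setT u ->
    measurable_fun setT (fun w => (chain m K' (x' w :: t w) (u w) * G)%:E).
  move=> cK'' mx mt mu'; apply/measurable_EFinP; apply: measurable_funM => //.
  apply: (@measurable_chain _ _ _ _ _ _ (fun w => [tuple of x' w :: t w])) => //.
  exact: measurable_cons.
rewrite integral_lebesgue_tupleS; last 2 first.
- by move=> t; apply: integral_ge0 => u _; rewrite lee_fin mulr_ge0// chain_ge0.
- apply: (@measurable_integral2 _ _ _ _ (tmu n.+1)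
    (fun (t u : n.+1.-tuple RT) => (chain n.+1 K (x :: t) u * G)%:E)).
    by move=> t u; rewrite lee_fin mulr_ge0// chain_ge0.
  exact: (mxt _ _ _ _ _ _ (cst x) fst snd).
have c0 : 0 <= c 0%N.
  by rewrite -lee_fin -(Kc _ 1)//; do 2 (apply: integral_ge0 => ? _); rewrite lee_fin.
transitivity (\int[mu]_a ((\int[mu]_b (K 0%N x b a)%:E) *
    (\prod_(i < n) c i.+1 * G)%:E))%E.
  apply: eq_integral => a _.
  have Kb0 : (0 <= \int[mu]_b (K 0%N x b a)%:E)%E.
    by apply: integral_ge0 => b _; rewrite lee_fin.
  transitivity ((\int[mu]_b (K 0%N x b a)%:E) * \int[tmu n]_t \int[tmu n]_u
      (chain n (fun i => K i.+1) (a :: t) u * G)%:E)%E.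
    rewrite -(ge0_integralZl _ measurableT) => [||t _|//]; last 2 first.
    - apply: (@measurable_integral2 _ _ _ _ (tmu n) (fun (t u : n.-tuple RT) =>
        (chain n (fun i => K i.+1) (a :: t) u * G)%:E)).
        by move=> t u; rewrite lee_fin mulr_ge0// chain_ge0.
      exact: (mxt _ _ _ _ _ _ (cst a) fst snd).
    - by apply: integral_ge0 => u _; rewrite lee_fin mulr_ge0// chain_ge0.
    by apply: eq_integral => t _; exact: integral_chain_cons.
  have [a0|a0] := ltP 0 a.
    by rewrite (IHn _ (fun i => c i.+1))// => i y iin; exact: Kc.
  rewrite (_ : (fun b => _) = cst 0%E) ?integral0 ?mul0e//.
  by apply/funext => b; rewrite zK// negb_and -!leNgt a0 orbT.
rewrite (ge0_integralZr _ measurableT) => [||a _|]; last 3 first.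
- apply: (@measurable_integral2 _ _ _ _ mu (fun a b : RT => (K 0%N x b a)%:E)) => [a b|].
    by rewrite lee_fin.
  by apply/measurable_EFinP; exact: (measurable_kernel_comp 0 cK).
- by apply: integral_ge0 => b _; rewrite lee_fin.
- rewrite lee_fin mulr_ge0// prodr_ge0// => i _.
  rewrite -lee_fin -(Kc i.+1 1)//; last exact: ltn_ord i.
  by do 2 (apply: integral_ge0 => ? _); rewrite lee_fin.
by rewrite Kc// -EFinM big_ord_recl mulrA.
Qed.

(** Peeling off the first vertex and its edge leaves a shorter chain.  Left of
    the root the kernel of the first edge is integrated out first, at a fixed
    value of the next vertex; right of the root it is integrated out last. *)
Lemma integral_chain n r K (c : nat -> R) (g : RT -> R) (Cg : \bar R) :
  chain_kernel K -> (r <= n)%N ->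
  (forall i x, (i < r)%N -> 0 < x ->
     (\int[mu]_a \int[mu]_b (K i a b x)%:E = (c i)%:E)%E) ->
  (forall i x, (r <= i < n)%N -> 0 < x ->
     (\int[mu]_a \int[mu]_b (K i x b a)%:E = (c i)%:E)%E) ->
  measurable_fun setT g -> (forall x, 0 <= g x) ->
  (forall x, ~~ (0 < x) -> g x = 0) -> (\int[mu]_x (g x)%:E = Cg)%E ->
  (\int[tmu n.+1]_t \int[tmu n]_u (chain n K t u * g (nth 0 t r))%:E =
   (\prod_(i < n) c i)%:E * Cg)%E.
Proof.
move=> + + + + mg g0 zg gC.
have mW m r' K' k : chain_kernel K' -> measurable_fun setT
    (fun w : k.-tuple RT * m.-tuple RT =>
       (chain m K' w.1 w.2 * g (nth 0 w.1 r'))%:E).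
  move=> cK'; apply/measurable_EFinP; apply: measurable_funM.
    exact: measurable_chain.
  apply: (measurableT_comp mg).
  exact: (measurable_nth _ measurable_fst).
have W0 m K' t u x : chain_kernel K' -> (0 <= (chain m K' t u * g x)%:E)%E.
  by move=> cK'; rewrite lee_fin mulr_ge0// chain_ge0.
elim: r n K c => [|r IHr] n K c cK rn Kl Kr.
  rewrite integral_lebesgue_tupleS; last 2 first.
  - by move=> t; apply: integral_ge0 => u _; exact: W0.
  - apply: (@measurable_integral2 _ _ _ _ (tmu n)
      (fun (t : n.+1.-tuple RT) (u : n.-tuple RT) => (chain n K t u * g (nth 0 t 0))%:E)).
      by move=> t u; exact: W0.
    exact: mW.
  have c0 : 0 <= \prod_(i < n) c i.
    apply: prodr_ge0 => i _; rewrite -lee_fin -(Kr i 1) ?ltn_ord//.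
    by do 2 (apply: integral_ge0 => ? _); rewrite lee_fin; case: cK.
  rewrite -gC -(ge0_integralZl _ measurableT) => [||x _|]; last 3 first.
  - by apply/measurable_EFinP.
  - by rewrite lee_fin.
  - by rewrite lee_fin.
  apply: eq_integral => x _ /=.
  have [x0|x0] := ltP 0 x.
    have := @integral_chain_right n K c x (g x) cK _ x0 (g0 x).
    by rewrite EFinM; apply => i y iin; exact: Kr.
  rewrite (zg x) -?leNgt// mule0.
  rewrite (_ : (fun t => _) = cst 0%E) ?integral0//; apply/funext => t.
  by rewrite (_ : (fun u => _) = cst 0%E) ?integral0//; apply/funext => u; rewrite mulr0.
case: n rn Kr => // n rn Kr.
have [K0 mK zK] := cK; have cK' := chain_kernelS cK.
have := IHr n (fun i => K i.+1) (fun i => c i.+1) cK' rn _ _.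
move=> /(_ (fun i x ir => Kl i.+1 x ir) (fun i x ir => Kr i.+1 x ir)) IH.
rewrite big_ord_recl EFinM -muleA -IH.
set W := fun t : n.+1.-tuple RT =>
  (\int[tmu n]_u (chain n (fun i => K i.+1) t u * g (nth 0 t r))%:E)%E.
have mW' : measurable_fun setT W.
  apply: (@measurable_integral2 _ _ _ _ (tmu n) (fun (t : n.+1.-tuple RT) (u : n.-tuple RT) =>
    (chain n (fun i => K i.+1) t u * g (nth 0 t r))%:E)) => [t u|]; first exact: W0.
  exact: mW.
have W0' t : (0 <= W t)%E by apply: integral_ge0 => u _; exact: W0.
have zW (t : n.+1.-tuple RT) : ~~ (0 < nth 0 t 0) -> W t = 0%E.
  move=> t0; rewrite /W (_ : (fun u => _) = cst 0%E) ?integral0//.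
  apply/funext => u; case: r {IHr IH W mW' W0' rn Kl Kr} => [|r].
    by rewrite zg// mulr0.
  case: n t t0 u => [|n] t t0 u.
    by rewrite zg ?mulr0// nth_default ?ltxx// size_tuple.
  by rewrite /chain big_ord_recl zK ?mul0r// negb_and t0.
rewrite integral_lebesgue_tupleS; last 2 first.
- by move=> t; apply: integral_ge0 => u _; exact: W0.
- apply: (@measurable_integral2 _ _ _ _ (tmu n.+1) (fun (t : n.+2.-tuple RT) (u : n.+1.-tuple RT) =>
    (chain n.+1 K t u * g (nth 0 t r.+1))%:E)).
    by move=> t u; exact: W0.
  exact: mW.
transitivity (\int[mu]_a \int[tmu n.+1]_t
    ((\int[mu]_b (K 0%N a b (nth 0 t 0))%:E) * W t))%E.
  by do 2 (apply: eq_integral => ? _); rewrite integral_chain_cons.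
have mKb : measurable_fun setT (fun w : RT * n.+1.-tuple RT =>
    \int[mu]_b (K 0%N w.1 b (nth 0 w.2 0))%:E)%E.
  apply: (@measurable_integral2 _ _ _ _ mu
    (fun (w : RT * n.+1.-tuple RT) (b : RT) => (K 0%N w.1 b (nth 0 w.2 0))%:E)).
    by move=> *; rewrite lee_fin.
  apply/measurable_EFinP; apply: (measurable_kernel_comp 0 cK) => //.
    exact: (measurableT_comp measurable_fst measurable_fst).
  apply: measurable_nth.
  exact: (measurableT_comp measurable_snd measurable_fst).
have Kb0 a x : (0 <= \int[mu]_b (K 0%N a b x)%:E)%E.
  by apply: integral_ge0 => b _; rewrite lee_fin.
rewrite (fubini_tonelli (fun w : RT * n.+1.-tuple RT =>
    (\int[mu]_b (K 0%N w.1 b (nth 0 w.2 0))%:E) * W w.2)%E); last 2 first.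
- apply: emeasurable_funM => //.
  exact: (measurableT_comp mW' measurable_snd).
- by move=> w; rewrite mule_ge0.
have c0 : 0 <= c 0%N.
  by rewrite -lee_fin -(Kl _ 1)//; apply: integral_ge0 => a _.
rewrite -(ge0_integralZl _ measurableT) => [|//||]; last 2 first.
- by move=> t _; exact: W0'.
- by rewrite lee_fin.
apply: eq_integral => t _ /=.
rewrite (ge0_integralZr _ measurableT) => [||//|//]; last first.
  exact: (measurableT_comp mKb (pair2_measurable t)).
rewrite -/(W t); have [t0|t0] := boolP (0 < nth 0 t 0); last by rewrite zW// !mule0.
by rewrite Kl.
Qed.

End chain_integral.

(** * The rooted path and its coordinates *)

Section rooted_path.
Variables (n : nat) (r : 'I_n).
Implicit Types i j a b : 'I_n.

(** The root is its own parent.  Together with the convention [t r = 0] this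
    lets the formulas for the other vertices hold at the root as well. *)
Definition parent i : 'I_n :=
  insubd r (if (i < r)%N then i.+1 else if (r < i)%N then i.-1 else i).

Definition depth i : nat := ((i - r) + (r - i))%N.

Lemma val_parent i : parent i =
  (if (i < r)%N then i.+1 else if (r < i)%N then i.-1 else i) :> nat.
Proof.
rewrite /parent -[LHS]/(val _) val_insubd; have := ltn_ord i; have := ltn_ord r.
by case: (ltngtP i r) => ?; case: ifP => //; lia.
Qed.

Lemma parent_root : parent r = r.
Proof. by apply: val_inj; rewrite /= val_parent ltnn. Qed.

Lemma depth_parent i : i != r -> (depth (parent i) < depth i)%N.
Proof.
by rewrite -val_eqE /depth val_parent /=; case: (ltngtP i r) => //= ir _; lia.
Qed.

Lemma parent_neq i : i != r -> parent i != i.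
Proof. by move=> /depth_parent; apply: contraTneq => ->; rewrite ltnn. Qed.

Lemma edge_parentE a b : edge a b = [|| a == b, parent a == b | parent b == a].
Proof.
rewrite /edge -!val_eqE /= !val_parent.
by case: (ltngtP a r); case: (ltngtP b r); move=> ? ?; lia.
Qed.

Lemma edge_parent i : edge i (parent i).
Proof. by rewrite edge_parentE eqxx orbT. Qed.

Lemma parent_ind (P : 'I_n -> Prop) :
  P r -> (forall i, i != r -> P (parent i) -> P i) -> forall i, P i.
Proof.
move=> Pr Ps i; have [k] := ubnP (depth i); elim: k i => // k IHk i.
rewrite ltnS => ik; have [->//|ir] := eqVneq i r.
by apply: Ps => //; apply: IHk; exact: leq_trans (depth_parent ir) ik.
Qed.

End rooted_path.

Section path_coordinates.
Variables (R : realType) (n : nat) (r : 'I_n).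
Implicit Types (i j a b : 'I_n) (y eta : 'M[R]_n) (D t : 'I_n -> R).
Local Notation par := (parent r).

(** A column of the Cholesky-type factor of [y]: supported on an edge, so that
    the rank-one matrices built from it stay in [ZG]. *)
Definition contrast t i : 'cV[R]_n := delta_mx i 0 - t i *: delta_mx (par i) 0.

(** The quadratic form of [eta] at the contrast of [i]; see [contrast_quad]. *)
Definition contrast_form t i eta : R :=
  eta i i - 2 * t i * eta i (par i) + t i ^+ 2 * eta (par i) (par i).

Definition slope eta i : R :=
  if i == r then 0 else eta i (par i) / eta (par i) (par i).

(** The Schur complement of the parent entry in the block of the edge from [i] to
    its parent; at the root, the diagonal entry. *)
Definition pivot eta i : R := contrast_form (slope eta) i eta.

Definition coordmx D t : 'M[R]_n :=
  \sum_i D i *: (contrast t i *m (contrast t i)^T).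

Lemma IG_sym y : IG y -> forall a b, y a b = y b a.
Proof. by move=> [yT _] a b; rewrite -{1}yT mxE. Qed.

Lemma delta_form y a b :
  ((delta_mx a 0 : 'cV[R]_n)^T *m y *m (delta_mx b 0 : 'cV[R]_n)) 0 0 = y a b.
Proof. by rewrite trmx_delta -rowE -colE !mxE. Qed.

Lemma contrast_dot t i (x : 'cV[R]_n) :
  ((contrast t i)^T *m x) 0 0 = x i 0 - t i * x (par i) 0.
Proof.
rewrite /contrast linearB /= linearZ /= mulmxBl -scalemxAl !trmx_delta -!rowE.
by rewrite !mxE.
Qed.

Lemma mulmx_contrast t i y a :
  (y *m contrast t i) a 0 = y a i - t i * y a (par i).
Proof. by rewrite /contrast mulmxBr -scalemxAr -!colE !mxE. Qed.

Lemma contrast_quad t i y : IG y ->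
  ((contrast t i)^T *m y *m contrast t i) 0 0 = contrast_form t i y.
Proof.
move=> yI; rewrite -mulmxA contrast_dot !mulmx_contrast /contrast_form.
by rewrite (IG_sym yI (par i) i); ring.
Qed.

Lemma contrast_ZG t i : t r = 0 -> ZG (contrast t i *m (contrast t i)^T).
Proof.
move=> tr; split=> [|a b]; first by rewrite trmx_mul trmxK.
rewrite (edge_parentE r) => /norP[ab /norP[ab' ba']].
rewrite mxE big_ord1 !mxE !eqxx !andbT.
have [ai|ai] := eqVneq a i.
  subst a; rewrite [b == i]eq_sym (negbTE ab) [b == par i]eq_sym (negbTE ab').
  by rewrite mulr0 subr0 mulr0.
rewrite [a == par i]eq_sym; have [pa|pa] := eqVneq (par i) a.
  subst a; have [bi|bi] := eqVneq b i; first by subst b; rewrite eqxx in ba'.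
  by rewrite [b == par i]eq_sym (negbTE ab) !mulr0 subr0 mulr0.
by rewrite mulr0 subr0 mul0r.
Qed.

Lemma coordmx_ZG D t : t r = 0 -> ZG (coordmx D t).
Proof.
move=> tr; split=> [|a b ab].
  rewrite /coordmx linear_sum /=; apply: eq_bigr => i _.
  by rewrite linearZ /=; congr (_ *: _); have [] := contrast_ZG i tr.
rewrite /coordmx summxE big1// => i _; rewrite mxE.
by have [_ ->//] := contrast_ZG i tr; rewrite mulr0.
Qed.

Lemma coordmx_quad D t (x : 'cV[R]_n) :
  (x^T *m coordmx D t *m x) 0 0 = \sum_i D i * (x i 0 - t i * x (par i) 0) ^+ 2.
Proof.
rewrite /coordmx mulmx_sumr mulmx_suml summxE; apply: eq_bigr => i _.
rewrite -scalemxAr -scalemxAl mxE; congr (_ * _).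
rewrite mulmxA -[_ *m _ *m x]mulmxA mxE big_ord1 contrast_dot expr2; congr (_ * _).
by rewrite -contrast_dot -[in RHS](trmxK x) -trmx_mul [RHS]mxE.
Qed.

Lemma coordmx_PG D t : t r = 0 -> (forall i, 0 < D i) -> PG (coordmx D t).
Proof.
move=> tr D0; split; first exact: coordmx_ZG.
move=> x x0; rewrite coordmx_quad.
have Dq0 i : 0 <= D i * (x i 0 - t i * x (par i) 0) ^+ 2.
  by rewrite mulr_ge0 ?sqr_ge0 ?(ltW (D0 i)).
rewrite lt_neqAle sumr_ge0// andbT eq_sym; apply: contra x0 => /eqP q0.
have xi i : x i 0 = t i * x (par i) 0.
  have /eqP : D i * (x i 0 - t i * x (par i) 0) ^+ 2 = 0.
    exact: (psumr_eq0P (fun i _ => Dq0 i) q0).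
  by rewrite mulf_eq0 gt_eqF//= sqrf_eq0 subr_eq0 => /eqP.
apply/eqP/matrixP => a b; rewrite (ord1 b) mxE.
elim/(@parent_ind _ r): a => [|i _ IHi]; rewrite xi; first by rewrite tr mul0r.
by rewrite IHi mulr0.
Qed.

(** The identity behind the pairing: a trace against [v v ^ T] is the value of
    the quadratic form at [v]. *)
Lemma pairing_coordmx D t eta : IG eta ->
  pairing (coordmx D t) eta = \sum_i D i * contrast_form t i eta.
Proof.
move=> eI; rewrite /pairing /coordmx mulmx_suml linear_sum /=.
apply: eq_bigr => i _; rewrite -scalemxAl linearZ /=; congr (_ * _).
by rewrite -mulmxA mxtrace_mulC -contrast_quad// /mxtrace big_ord1.
Qed.

(** Gaussian elimination of a leaf does not create new entries, since the only
    neighbour it has left is its parent: the step subtracts a multiple of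
    [v *m v^T] with [v] a contrast.  The induction is on a parent-closed set
    [S] of vertices not yet eliminated, outside which the matrix vanishes. *)
Lemma PG_coordmx y : PG y ->
  exists D t, [/\ forall i, 0 < D i, t r = 0 & y = coordmx D t].
Proof.
move=> [[yT yE] y0].
suff H k (S : {set 'I_n}) (Y : 'M[R]_n) : #|S| = k ->
    (forall i, i \in S -> par i \in S) -> IG Y ->
    (forall a b, a \notin S -> Y a b = 0) ->
    (forall x : 'cV[R]_n, x != 0 -> (forall j, j \notin S -> x j 0 = 0) ->
       0 < (x^T *m Y *m x) 0 0) ->
    exists D t, [/\ forall i, i \in S -> 0 < D i, t r = 0 &
      Y = \sum_(i in S) D i *: (contrast t i *m (contrast t i)^T)].
  have [||||D [t [D0 tr ->]]] := H _ [set: 'I_n]%SET y erefl.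
  - by move=> i _; rewrite inE.
  - by split.
  - by move=> a b; rewrite inE.
  - by move=> x x0 _; exact: y0.
  exists D, t; split=> // [i|]; first by apply: D0; rewrite inE.
  by rewrite /coordmx; apply: eq_bigl => i; rewrite inE.
elim: k S Y => [|k IHk] S Y Sk Spar YI YS Y0.
  exists (fun=> 0), (fun=> 0); move/cards0_eq : Sk => S0; subst S.
  split=> // [i|]; first by rewrite inE.
  by rewrite big_set0; apply/matrixP => a b; rewrite YS ?mxE// inE.
have [i0 i0S] : exists i, i \in S by apply/card_gt0P; rewrite Sk.
pose i := [arg max_(i > i0 in S) depth r i]%N.
have [iS imax] : i \in S /\ forall j, j \in S -> (depth r j <= depth r i)%N.
  by rewrite /i; case: arg_maxnP.
(* Among the surviving vertices, a deepest one has no neighbour but its parent. *)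
have Yi b : b != i -> b != par i -> Y i b = 0.
  move=> bi bp; have [bS|bS] := boolP (b \in S); last first.
    by rewrite (IG_sym YI) YS.
  apply: YI.2; rewrite (edge_parentE r) eq_sym (negbTE bi) eq_sym (negbTE bp) /=.
  apply/eqP => pbi; have br : b != r.
    by apply: contra bi => /eqP br; rewrite -pbi br parent_root.
  by have := leq_trans (depth_parent br) (imax _ bS); rewrite pbi ltnn.
have Yii : 0 < Y i i.
  rewrite -delta_form; apply: Y0.
    by apply/eqP => /matrixP/(_ i 0)/eqP; rewrite !mxE !eqxx oner_eq0.
  by move=> j jS; rewrite mxE; case: eqP => // ji; rewrite ji iS in jS.
pose ti := if i == r then 0 else - (Y i (par i) / Y i i).
pose t0 := (fun j => if j == i then ti else 0) : 'I_n -> R.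
have t0r : t0 r = 0 by rewrite /t0 /ti; case: eqVneq => // ->; rewrite eqxx.
pose v := contrast t0 i.
have vE a : v a 0 = (a == i)%:R - ti * (a == par i)%:R.
  by rewrite /v /contrast /t0 eqxx !mxE !eqxx !andbT.
pose Y' := Y - Y i i *: (v *m v^T).
have Y'E a b : Y' a b = Y a b - Y i i * (v a 0 * v b 0).
  have <- : (v *m v^T) a b = v a 0 * v b 0.
    by rewrite mxE big_ord1; congr (_ * _); rewrite [LHS]mxE.
  by rewrite /Y'; move: (v *m v^T) => V; rewrite !mxE.
have Y'I : IG Y'.
  have [vT vE'] := contrast_ZG i t0r; have [YT YE] := YI.
  split=> [|a b ab]; first by rewrite linearB /= linearZ /= YT vT.
  have := vE' a b ab; rewrite mxE big_ord1 [_^T _ _]mxE => vab.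
  by rewrite Y'E YE// vab mulr0 subr0.
have pe : (par i == i) = (i == r).
  by have [->|/parent_neq/negbTE//] := eqVneq i r; rewrite parent_root eqxx.
have Y'i b : Y' i b = 0.
  rewrite Y'E !vE eqxx [i == par i]eq_sym pe.
  rewrite /ti; have [ir|ir] := eqVneq i r.
    rewrite !mul0r !subr0 mul1r; have [->|bi] := eqVneq b i; first by rewrite mulr1 subrr.
    have pi : par i = i by apply/eqP; rewrite pe ir.
    by rewrite mulr0 subr0 Yi// pi.
  rewrite mulr0 subr0 mul1r; have [->|bi] := eqVneq b i.
    by rewrite [i == par i]eq_sym pe (negbTE ir) mulr0 subr0 mulr1 subrr.
  have [->|bp] := eqVneq b (par i); last by rewrite mulr0 subr0 mulr0 subr0 Yi.
  by rewrite mulr1 sub0r opprK mulrCA mulfV ?gt_eqF// mulr1 subrr.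
have Y'S a b : a \notin S :\ i -> Y' a b = 0.
  rewrite !inE negb_and negbK => /orP[/eqP->//|aS].
  have ai : a != i by apply: contraNneq aS => ->.
  have ap : a != par i by apply: contraNneq aS => ->; exact: Spar.
  rewrite Y'E !vE (negbTE ai) (negbTE ap) YS//.
  by rewrite mulr0 subr0 mul0r mulr0 subr0.
have Y'0 (z : 'cV[R]_n) : z != 0 -> (forall j, j \notin S :\ i -> z j 0 = 0) ->
    0 < (z^T *m Y' *m z) 0 0.
  move=> z0 zS; have zi : z i 0 = 0 by apply: zS; rewrite !inE eqxx.
  (* Moving [z] along [e_i] until it is orthogonal to the eliminated contrast
     does not change the reduced form and makes it agree with the old one. *)
  pose w := z + (ti * z (par i) 0) *: (delta_mx i 0 : 'cV[R]_n).
  have wE a : w a 0 = z a 0 + ti * z (par i) 0 * (a == i)%:R.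
    by rewrite !mxE eqxx andbT.
  have vw : v^T *m w = 0.
    apply/matrixP => a b; rewrite (ord1 a) (ord1 b) contrast_dot /t0 eqxx !wE.
    by rewrite eqxx pe zi [RHS]mxE /ti; case: (i == r) => /=; ring.
  have Y'd : Y' *m (delta_mx i 0 : 'cV[R]_n) = 0.
    by apply/matrixP => a b; rewrite -colE mxE (IG_sym Y'I) Y'i mxE.
  have -> : z^T *m Y' *m z = w^T *m Y *m w.
    have Y'w : Y' *m w = Y' *m z.
      by rewrite /w mulmxDr -scalemxAr Y'd scaler0 addr0.
    have wY' : w^T *m Y' = z^T *m Y'.
      by rewrite -[LHS]trmxK trmx_mul trmxK Y'I.1 Y'w trmx_mul Y'I.1.
    have Yw : Y' *m w = Y *m w.
      by rewrite /Y' mulmxBl -scalemxAl -mulmxA vw mulmx0 scaler0 subr0.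
    by rewrite -wY' -mulmxA -Y'w Yw mulmxA.
  apply: Y0 => [|j jS].
    apply: contra z0 => /eqP w0; apply/eqP/matrixP => a b; rewrite (ord1 b).
    have [->|ai] := eqVneq a i; first by rewrite zi mxE.
    by have := wE a; rewrite w0 (negbTE ai) mulr0 addr0 !mxE => <-.
  rewrite wE zS ?inE ?(negbTE jS) ?andbF//.
  by rewrite (_ : (j == i) = false) ?mulr0 ?addr0//; apply: contraNF jS => /eqP->.
have Si : #|S :\ i| = k by move: Sk; rewrite (cardsD1 i) iS => -[].
have Spar' j : j \in S :\ i -> par j \in S :\ i.
  rewrite !inE => /andP[ji jS]; rewrite Spar// andbT; apply/eqP => pji.
  have [jr|jr] := eqVneq j r; first by rewrite jr parent_root in pji; rewrite jr pji eqxx in ji.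
  by have := leq_trans (depth_parent jr) (imax _ jS); rewrite pji ltnn.
have [D [t [D0 tr Y'D]]] := IHk _ Y' Si Spar' Y'I Y'S Y'0.
exists (fun j => if j == i then Y i i else D j), (fun j => if j == i then ti else t j).
split=> [j jS||].
- by case: eqVneq => // ji; apply: D0; rewrite !inE ji.
- by rewrite /ti eq_sym; case: eqP.
rewrite (big_setD1 i)//= eqxx -[LHS](subrK (Y i i *: (v *m v^T))) -/Y' addrC.
have -> : contrast (fun j => if j == i then ti else t j) i = v.
  by rewrite /v /contrast /t0 eqxx.
congr (_ + _); rewrite Y'D; apply: eq_bigr => j; rewrite !inE => /andP[ji _].
by rewrite /contrast (negbTE ji).
Qed.

(** Completing the square in [t i]; the completed form separates the pivot of
    the matrix from the discrepancy between the two slopes. *)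
Lemma contrast_form_pivot t i eta : t r = 0 -> eta (par i) (par i) != 0 ->
  contrast_form t i eta =
  pivot eta i + (t i - slope eta i) ^+ 2 * eta (par i) (par i).
Proof.
move=> tr ep; rewrite /pivot /contrast_form /slope.
have [->|ir] := eqVneq i r; first by rewrite tr; ring.
by field.
Qed.

Lemma pivotE eta i : eta (par i) (par i) != 0 ->
  eta i i = pivot eta i + slope eta i ^+ 2 * eta (par i) (par i).
Proof.
move=> ep; rewrite /pivot /contrast_form /slope; case: eqP => [_|_]; first by ring.
by field.
Qed.

Lemma slope_root eta : slope eta r = 0.
Proof. by rewrite /slope eqxx. Qed.

Lemma pivot_root eta : pivot eta r = eta r r.
Proof. by rewrite /pivot /contrast_form /slope eqxx; ring. Qed.

Lemma pivot_sub eta i : i != r ->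
  pivot eta i = eta i i - eta i (par i) ^+ 2 / eta (par i) (par i).
Proof.
move=> ir; rewrite /pivot /contrast_form /slope (negbTE ir).
have [->|x0] := eqVneq (eta (par i) (par i)) 0; last by field.
by rewrite invr0; ring.
Qed.

Definition pivotal eta := IG eta /\ forall i, 0 < pivot eta i.

Lemma pivotal_diag_gt0 eta i : (forall i, 0 < pivot eta i) -> 0 < eta i i.
Proof.
move=> p0; elim/(@parent_ind _ r): i => [|i ir IHi]; first by rewrite -pivot_root.
by rewrite pivotE ?gt_eqF// ltr_wpDr// mulr_ge0 ?sqr_ge0// ltW.
Qed.

Lemma contrast_form_gt0 t i eta : t r = 0 -> (forall i, 0 < pivot eta i) ->
  0 < contrast_form t i eta.
Proof.
move=> tr p0; have d0 := pivotal_diag_gt0 _ p0.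
by rewrite contrast_form_pivot ?gt_eqF// ltr_wpDr// mulr_ge0 ?sqr_ge0// ltW.
Qed.

Lemma pairing_coordmx_gt0 D t eta : t r = 0 -> (forall i, 0 < D i) ->
  pivotal eta -> 0 < pairing (coordmx D t) eta.
Proof.
move=> tr D0 [eI p0]; rewrite pairing_coordmx// (bigD1 r)//=.
rewrite ltr_wpDr ?mulr_gt0 ?contrast_form_gt0//.
by apply: sumr_ge0 => i _; rewrite mulr_ge0// ltW// contrast_form_gt0.
Qed.

(** The diagonal is recovered from the root outwards, each entry from its pivot,
    its slope and the entry of its parent. *)
Lemma pivotal_inj eta eta' : pivotal eta -> pivotal eta' ->
  pivot eta =1 pivot eta' -> slope eta =1 slope eta' -> eta = eta'.
Proof.
move=> [eI p0] [eI' p0'] pE sE.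
have d0 i := pivotal_diag_gt0 i p0; have d0' i := pivotal_diag_gt0 i p0'.
have dE i : eta i i = eta' i i.
  elim/(@parent_ind _ r): i => [|i ir IHi]; first by rewrite -!pivot_root.
  by rewrite pivotE ?gt_eqF// [RHS]pivotE ?gt_eqF// pE sE IHi.
have pE' i : eta i (par i) = eta' i (par i).
  have [->|ir] := eqVneq i r; first by rewrite parent_root.
  have := sE i; rewrite /slope (negbTE ir) dE.
  by apply: mulIf; rewrite invr_eq0 gt_eqF.
apply/matrixP => a b; have [ab|nab] := boolP (edge a b); last by rewrite eI.2// eI'.2.
move: ab; rewrite (edge_parentE r) => /or3P[/eqP<-|/eqP<-|/eqP<-] //.
by rewrite (IG_sym eI) (IG_sym eI').
Qed.

End path_coordinates.

(** * The dual cone *)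

Section cone_duality.
Variables (R : realType) (n : nat) (r : 'I_n).
Implicit Types (i j a b : 'I_n) (y eta : 'M[R]_n) (D t : 'I_n -> R).
Local Notation par := (parent r).
Local Notation contrast_form := (contrast_form r).
Local Notation coordmx := (coordmx r).
Local Notation pivot := (pivot r).
Local Notation slope := (slope r).
Local Notation pivotal := (pivotal r).

Lemma form_le_pairing D t eta i : t r = 0 -> (forall i, 0 < D i) ->
  pivotal eta -> D i * contrast_form t i eta <= pairing (coordmx D t) eta.
Proof.
move=> tr D0 [eI p0]; rewrite pairing_coordmx// (bigD1 i)//= lerDl.
by apply: sumr_ge0 => j _; rewrite mulr_ge0 ?(ltW (D0 j))// ltW// contrast_form_gt0.
Qed.

(** Along the path from the root, each diagonal entry is controlled by its own
    term of the pairing and by the entry of its parent. *)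
Lemma diag_le_pairing D t : t r = 0 -> (forall i, 0 < D i) ->
  exists2 C, 0 <= C & forall eta i, pivotal eta ->
    eta i i <= C * pairing (coordmx D t) eta.
Proof.
move=> tr D0.
have H i : exists2 C, 0 <= C & forall eta, pivotal eta ->
    eta i i <= C * pairing (coordmx D t) eta.
  elim/(@parent_ind _ r): i => [|i ir [C C0 IHC]].
    exists (D r)^-1 => [|eta pe]; first by rewrite invr_ge0 ltW.
    rewrite ler_pdivlMl//; have := form_le_pairing r tr D0 pe.
    rewrite contrast_form_pivot ?parent_root ?gt_eqF ?(pivotal_diag_gt0 _ pe.2)//.
    rewrite /pivot /contrast_form /slope eqxx tr.
    by rewrite (_ : _ - _ + _ + _ = eta r r) //; ring.
  exists (2 / D i + 2 * t i ^+ 2 * C) => [|eta pe].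
    by rewrite addr_ge0 ?divr_ge0 ?(ltW (D0 i))// mulr_ge0// mulr_ge0// sqr_ge0.
  have pp0 := pivotal_diag_gt0 (par i) pe.2.
  have := form_le_pairing i tr D0 pe.
  rewrite contrast_form_pivot ?gt_eqF// [eta i i](@pivotE _ _ r) ?gt_eqF//.
  rewrite -ler_pdivlMl// => h; have {}IHC := IHC _ pe.
  have p0 := pe.2 i; set q := pairing _ _ in h IHC *.
  have h2 : 2 * t i ^+ 2 * eta (par i) (par i) <= 2 * t i ^+ 2 * (C * q).
    by rewrite ler_wpM2l// mulr_ge0 ?sqr_ge0.
  (* [slope = t - (t - slope)] and [(a - b) ^+ 2 <= 2 * a ^+ 2 + 2 * b ^+ 2]. *)
  have h3 : slope eta i ^+ 2 <= 2 * (t i - slope eta i) ^+ 2 + 2 * t i ^+ 2.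
    by have := sqr_ge0 (2 * t i - slope eta i); nra.
  have h4 : slope eta i ^+ 2 * eta (par i) (par i) <=
     (2 * (t i - slope eta i) ^+ 2 + 2 * t i ^+ 2) * eta (par i) (par i).
    by rewrite ler_wpM2r// ltW.
  have -> : (2 / D i + 2 * t i ^+ 2 * C) * q =
      2 * ((D i)^-1 * q) + 2 * t i ^+ 2 * (C * q) by ring.
  by lra.
have /choice[C HC] i : exists C, 0 <= C /\ forall eta, pivotal eta ->
    eta i i <= C * pairing (coordmx D t) eta.
  by have [C C0 HC] := H i; exists C.
exists (\sum_i C i) => [|eta i pe]; first by apply: sumr_ge0 => i _; have [] := HC i.
apply: le_trans ((HC i).2 _ pe) _; rewrite ler_wpM2r//.
  by rewrite ltW// pairing_coordmx_gt0.
by rewrite (bigD1 i)//= lerDl; apply: sumr_ge0 => j _; have [] := HC j.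
Qed.

Lemma scalar_IG : IG (1%:M : 'M[R]_n).
Proof.
split=> [|a b]; first by rewrite trmx1.
by rewrite (edge_parentE r) => /norP[/negbTE ab _]; rewrite mxE ab.
Qed.

(** The trace is the pairing with the identity, so both sides are sums over the
    same rank-one matrices and can be compared term by term.  Both terms are
    quadratic in [t i], and the one of [eta] is coercive. *)
Lemma trace_le_pairing eta : pivotal eta ->
  exists2 C, 0 <= C & forall y, PG y -> \tr y <= C * pairing y eta.
Proof.
move=> pe; have [eI p0] := pe; have d0 i := pivotal_diag_gt0 i p0.
pose c i := (1 + 2 * slope eta i ^+ 2) / pivot eta i + 2 / eta (par i) (par i).
have c0 i : 0 <= c i.
  rewrite /c addr_ge0 ?divr_ge0 ?(ltW (p0 _)) ?(ltW (d0 _))//.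
  by rewrite addr_ge0// mulr_ge0 ?sqr_ge0.
exists (\sum_i c i) => [|y]; first by apply: sumr_ge0 => i _.
move=> /(PG_coordmx r)[D [t [D0 tr ->]]].
have -> : \tr (coordmx D t) = pairing (coordmx D t) 1%:M by rewrite /pairing mulmx1.
rewrite !pairing_coordmx//; last exact: scalar_IG.
rewrite mulr_sumr; apply: ler_sum => i _; rewrite mulrCA ler_wpM2l ?(ltW (D0 i))//.
have form1 : contrast_form t i 1%:M <= 1 + t i ^+ 2.
  rewrite /contrast_form !mxE !eqxx mulr1.
  have [->|ir] := eqVneq i r; first by rewrite tr mulr0 mul0r subr0.
  by rewrite eq_sym (negbTE (parent_neq ir)) mulr0 subr0.
apply: le_trans form1 _; rewrite contrast_form_pivot ?gt_eqF//.
apply: (@le_trans _ _ (c i * (pivot eta i +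
    (t i - slope eta i) ^+ 2 * eta (par i) (par i)))); last first.
  rewrite ler_wpM2r//.
    by rewrite addr_ge0 ?(ltW (p0 i))// mulr_ge0 ?sqr_ge0 ?ltW.
  by rewrite (bigD1 i)//= lerDl; apply: sumr_ge0.
have pi0 := p0 i; have dp := d0 (par i).
set u := slope eta i in c c0 *; set P := pivot eta i in c c0 pi0 *.
set x := eta _ _ in c c0 dp *; set v := t i.
have -> : c i * (P + (v - u) ^+ 2 * x) = (1 + 2 * u ^+ 2) + 2 * (v - u) ^+ 2 +
    (2 / x * P + (1 + 2 * u ^+ 2) / P * ((v - u) ^+ 2 * x)).
  by rewrite /c -/u -/P -/x; field; rewrite !gt_eqF.
apply: (@le_trans _ _ ((1 + 2 * u ^+ 2) + 2 * (v - u) ^+ 2)).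
  by have := sqr_ge0 (v - 2 * u); nra.
have u2 := sqr_ge0 u; have vu2 := sqr_ge0 (v - u).
rewrite lerDl addr_ge0//; apply: mulr_ge0; rewrite ?(ltW pi0)//.
- by rewrite divr_ge0// ltW.
- by rewrite divr_ge0 ?(ltW pi0)// addr_ge0// mulr_ge0.
- by rewrite mulr_ge0// ltW.
Qed.

Lemma PG_form_ge0 y (x : 'cV[R]_n) : PG y -> 0 <= (x^T *m y *m x) 0 0.
Proof.
move=> [_ y0]; have [->|x0] := eqVneq x 0; last exact/ltW/y0.
by rewrite mulmx0 mxE.
Qed.

Lemma PG_entry_le_trace y a b : PG y -> `|y a b| <= \tr y.
Proof.
move=> yP; have yI : IG y := yP.1.
have d0 c : 0 <= y c c by rewrite -delta_form; exact: PG_form_ge0.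
have dtr c : y c c <= \tr y.
  by rewrite /mxtrace (bigD1 c)//= lerDl; apply: sumr_ge0.
have form (e : R) : e ^+ 2 = 1 -> 0 <= y a a + y b b + 2 * e * y a b.
  move=> e2; pose x := delta_mx a 0 + e *: delta_mx b 0 : 'cV[R]_n.
  have := PG_form_ge0 x yP; rewrite /x mulmxDr -scalemxAr.
  have -> : (delta_mx a 0 + e *: delta_mx b 0 : 'cV[R]_n)^T =
      (delta_mx a 0)^T + e *: (delta_mx b 0)^T.
    by rewrite linearD linearZ.
  rewrite mulmxDl -scalemxAl !mulmxDl -!scalemxAl.
  have E0 (u w : 'M[R]_1) : (u + e *: w) 0 0 = u 0 0 + e * w 0 0 by rewrite !mxE.
  rewrite !E0; have S c d := delta_form y c d.
  move: (S a a) (S a b) (S b a) (S b b).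
  move=> -> -> -> ->.
  rewrite (IG_sym yI b a); move: e2; set u := y a a; set w := y b b; set z := y a b.
  by move=> e2; rewrite mulrDr !mulrA -expr2 e2; lra.
have h1 := form 1 (expr1n _ _).
have h2 : 0 <= y a a + y b b + 2 * -1 * y a b by apply: form; rewrite sqrrN expr1n.
have := dtr a; have := dtr b; rewrite ler_norml; move: h1 h2; lra.
Qed.

Lemma continuous_pairing eta : continuous (fun y : 'M[R]_n => pairing y eta).
Proof.
rewrite (_ : (fun y => _) = (fun y : 'M[R]_n => \sum_a \sum_b y a b * eta b a)).
  apply: continuous_big => [|a _]; first exact: add_continuous.
  apply: continuous_big => [|b _]; first exact: add_continuous.
  by move=> y; exact: (cvgMr_tmp (@coord_continuous R n n a b y)).
apply/funext => y; rewrite /pairing /mxtrace.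
by apply: eq_bigr => a _; rewrite mxE.
Qed.

Lemma closure_PG_ge0 (f : 'M[R]_n -> R) y : continuous f ->
  (forall y, PG y -> 0 <= f y) -> closure (@PG R n) y -> 0 <= f y.
Proof.
move=> cf f0; rewrite closureEbigcap => /(_ (f @^-1` [set x | 0 <= x])); apply.
split; last exact: f0.
by apply: preimage_closed; [move=> x _; exact: cf|exact: closed_ge].
Qed.

(** Adding a small multiple of a matrix with unit weights makes the rank-one
    matrix positive definite. *)
Lemma contrast_closure_PG t i : t r = 0 ->
  closure (@PG R n) (contrast r t i *m (contrast r t i)^T).
Proof.
move=> tr B nB.
pose v := contrast r t i *m (contrast r t i)^T.
have cvgv : (v + e *: coordmx (fun=> 1) t) @[e --> (0 : R)^'+] --> v.
  rewrite -[X in _ --> X]addr0 -(scale0r (coordmx (fun=> 1) t)).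
  apply: cvgD; first exact: cvg_cst.
  by apply: cvgZr_tmp; apply: cvg_at_right_filter; exact: cvg_id.
have [e [Be e0]] : exists e : R, B (v + e *: coordmx (fun=> 1) t) /\ 0 < e.
  apply: (@filter_ex _ (0 : R)^'+); near=> e; split; near: e.
    exact: cvgv.
  exact: nbhs_right_gt.
exists (v + e *: coordmx (fun=> 1) t); split=> //.
have -> : v + e *: coordmx (fun=> 1) t = coordmx (fun j => (j == i)%:R + e) t.
  rewrite /coordmx scaler_sumr.
  under [RHS]eq_bigr do rewrite scalerDl.
  rewrite big_split/=; congr (_ + _).
    rewrite (bigD1 i)//= eqxx scale1r big1 ?addr0// => j /negbTE ->.
    by rewrite scale0r.
  by apply: eq_bigr => j _; rewrite scale1r.
by apply: coordmx_PG => // j; rewrite ltr_wpDl.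
Unshelve. all: by end_near. Qed.

(** The closed cone is spanned by rank-one matrices on the edges, and testing
    against those yields the pivots.  Conversely a positive definite matrix is
    bounded, in trace, by its pairing, and this bound passes to the closure. *)
Lemma QG_pivotal eta : QG eta <-> pivotal eta.
Proof.
split=> [[eI e0]|pe]; last first.
  split=> [|y cy y0]; first exact: pe.1.
  have [C C0 HC] := trace_le_pairing pe.
  have trE z : \tr z = pairing z 1%:M :> R by rewrite /pairing mulmx1.
  have tr_le : \tr y <= C * pairing y eta.
    have pE z : pairing z (C *: eta - 1%:M) = C * pairing z eta - \tr z.
      by rewrite trE /pairing mulmxBr -scalemxAr linearB linearZ.
    rewrite -subr_ge0 -pE.
    apply: (closure_PG_ge0 (f := fun z => pairing z (C *: eta - 1%:M))) cy => [|z zP].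
      exact: continuous_pairing.
    by rewrite pE subr_ge0; exact: HC.
  have entry_le a b : `|y a b| <= \tr y.
    rewrite -subr_ge0 trE.
    apply: (closure_PG_ge0 (f := fun y => pairing y 1%:M - `|y a b|)) cy => [|z zP].
      move=> z; apply: (cvgB (@continuous_pairing 1%:M z)).
      exact: (cvg_norm (@coord_continuous R n n a b z)).
    by rewrite subr_ge0 -trE; exact: PG_entry_le_trace.
  rewrite ltNge; apply/negP => q0; move/eqP : y0; apply; apply/matrixP => a b.
  have Cq : C * pairing y eta <= 0 by rewrite mulr_ge0_le0.
  apply/eqP; rewrite mxE -normr_le0 (le_trans (entry_le a b))//.
  exact: le_trans tr_le Cq.
split=> // i.
have tr := slope_root r eta.
pose v := contrast r (slope eta) i.
have -> : pivot eta i = pairing (v *m v^T) eta.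
  by rewrite /pairing -mulmxA mxtrace_mulC /pivot -contrast_quad// /mxtrace big_ord1.
apply: e0; first exact: contrast_closure_PG.
apply/eqP => /matrixP/(_ i i); rewrite !mxE big_ord1 !mxE !eqxx !andbT => /eqP.
have [->|ir] := eqVneq i r; first by rewrite tr mul0r subr0 mulr1 oner_eq0.
rewrite [i == par i]eq_sym (negbTE (parent_neq ir)).
by rewrite mulr0 subr0 mulr1 oner_eq0.
Qed.

End cone_duality.

(** * The density in terms of pivots *)

Section telescoping.
Variable R : realType.
Implicit Types (X P S : nat -> R) (M n : nat).

Lemma powR_shift_left X P S M : (0 < M)%N -> S 0 = 0 ->
  (forall i, 0 < X i) -> (forall i, 0 < P i) ->
  \prod_(1 <= i < M) (P i * X i.+1) `^ S i =
  \prod_(1 <= i < M) P i `^ S i *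
    (\prod_(2 <= i < M) X i `^ S i.-1 * X M `^ S M.-1).
Proof.
case: M => // M _ S0 X0 P0.
under eq_bigr do rewrite powRM ?ltW//.
rewrite big_split/=; congr (_ * _).
case: M => [|M]; first by rewrite !big_geq// S0 powRr0 mulr1.
by rewrite [in RHS]big_add1 /= -big_nat_recr.
Qed.

Lemma powR_shift_right X P S M n : (M <= n)%N -> S n.+1 = 0 ->
  (forall i, 0 < X i) -> (forall i, 0 < P i) ->
  \prod_(M.+1 <= i < n.+1) (P i * X i.-1) `^ S i =
  \prod_(M.+1 <= i < n.+1) P i `^ S i *
    (X M `^ S M.+1 * \prod_(M.+1 <= i < n) X i `^ S i.+1).
Proof.
move=> Mn Sn X0 P0.
under eq_bigr do rewrite powRM ?ltW//.
rewrite big_split/=; congr (_ * _).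
rewrite big_add1 /=; move: Mn; rewrite leq_eqVlt => /predU1P[->|Mn].
  by rewrite !big_geq// Sn powRr0 mulr1.
by rewrite big_ltn.
Qed.

(** With [X] the diagonal entries and [P] the pivots, a minor is a pivot times
    the diagonal entry of the parent, and the exponents of the denominator are
    those with which each diagonal entry occurs as a parent.  The term [- S M]
    at the root is left over as the contribution of the root itself. *)
Lemma delta_telescope X P S M n : (0 < M <= n)%N -> S 0 = 0 -> S n.+1 = 0 ->
  (forall i, 0 < X i) -> (forall i, 0 < P i) ->
  (\prod_(1 <= i < M) (P i * X i.+1) `^ S i *
    \prod_(M.+1 <= i < n.+1) (P i * X i.-1) `^ S i) /
  (\prod_(2 <= i < M) X i `^ S i.-1 *
   X M `^ (S M.-1 - S M + S M.+1) *
   \prod_(M.+1 <= i < n) X i `^ S i.+1) =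
  \prod_(1 <= i < M) P i `^ S i * \prod_(M.+1 <= i < n.+1) P i `^ S i *
    X M `^ S M.
Proof.
move=> /andP[M0 Mn] S0 Sn X0 P0.
rewrite powR_shift_left// powR_shift_right//.
have -> : X M `^ (S M.-1 - S M + S M.+1) =
    X M `^ S M.-1 * X M `^ S M.+1 / X M `^ S M.
  have XD u v : X M `^ (u + v) = X M `^ u * X M `^ v.
    by rewrite powRD// (gt_eqF (X0 M)) implybT.
  by rewrite !XD powRN mulrAC.
have prod0 m k (S' : nat -> R) : \prod_(m <= i < k) X i `^ S' i != 0.
  by rewrite gt_eqF// prodr_gt0// => i _; rewrite powR_gt0.
have Xn0 u : X M `^ u != 0 by rewrite gt_eqF// powR_gt0.
have := prod0 2 M (fun i => S i.-1); have := prod0 M.+1 n (fun i => S i.+1).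
set A := \prod_(1 <= i < M) _; set B := \prod_(M.+1 <= i < n.+1) _.
set C := \prod_(2 <= i < M) _; set D := \prod_(M.+1 <= i < n) _ => D0 C0.
by field; rewrite !Xn0 D0 C0.
Qed.

Lemma diag_telescope X M n : (0 < M <= n)%N -> (1 < n)%N ->
  \prod_(2 <= i < n) X i * X M =
  \prod_(1 <= i < M) X i.+1 * \prod_(M.+1 <= i < n.+1) X i.-1.
Proof.
move=> /andP[M0 Mn] n1.
have -> : \prod_(1 <= i < M) X i.+1 = \prod_(2 <= i < M.+1) X i.
  by rewrite [RHS]big_add1.
rewrite [X in _ = _ * X]big_add1 /=.
case: M M0 Mn => // -[_ _|M _ Mn].
  by rewrite [in RHS]big_geq// mul1r [in RHS]big_ltn// mulrC.
move: Mn; rewrite leq_eqVlt => /predU1P[<-|Mn].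
  by rewrite [X in _ = _ * X]big_geq// mulr1 [in RHS]big_nat_recr.
rewrite [in RHS]big_nat_recr//= (@big_cat_nat _ _ _ M.+2)//= 1?ltnW//.
by rewrite mulrAC.
Qed.

(** A minor contains the diagonal entry of its parent to the power
    [- 3 / 2 = - 2^-1 - 1].  The factors [X ^-1] count each vertex as often as it
    is a parent; the product over the inner vertices cancels them, except for one
    factor at the root. *)
Lemma phi_telescope X P M n : (0 < M <= n)%N -> (1 < n)%N ->
  (forall i, 0 < X i) -> (forall i, 0 < P i) ->
  \prod_(1 <= i < M) (P i * X i.+1) `^ (- (3 / 2)) *
    \prod_(M.+1 <= i < n.+1) (P i * X i.-1) `^ (- (3 / 2)) *
    \prod_(2 <= i < n) X i =
  \prod_(1 <= i < M) (P i `^ (- (3 / 2)) * X i.+1 `^ (- 2^-1)) *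
    \prod_(M.+1 <= i < n.+1) (P i `^ (- (3 / 2)) * X i.-1 `^ (- 2^-1)) /
    X M.
Proof.
move=> Mn n1 X0 P0.
have PX (p x : R) : 0 < p -> 0 < x -> (p * x) `^ (- (3 / 2)) =
    (p `^ (- (3 / 2)) * x `^ (- 2^-1)) * x^-1.
  move=> p0 x0; rewrite powRM ?ltW// -mulrA; congr (_ * _).
  rewrite -[x^-1]powR_inv1 ?ltW// -powRD; last by rewrite (gt_eqF x0) implybT.
  by congr (_ `^ _); field.
under eq_bigr do rewrite PX//.
under [X in _ * X * _]eq_bigr do rewrite PX//.
rewrite !big_split/= !prodfV.
have := diag_telescope X Mn n1.
have prod0 m k (f : nat -> nat) : \prod_(m <= i < k) X (f i) != 0.
  by rewrite gt_eqF// prodr_gt0.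
have := prod0 M.+1 n.+1 predn; have := prod0 1 M succn.
set A := \prod_(1 <= i < M) X _; set B := \prod_(M.+1 <= i < n.+1) X _.
set C := \prod_(2 <= i < n) _ => A0 B0 CE.
have XM0 : X M != 0 by rewrite gt_eqF.
have -> : C = A * B / X M by rewrite -CE mulfK.
by field; rewrite XM0 A0 B0.
Qed.

End telescoping.

Section density_coordinates.
Variables (R : realType) (n : nat) (r : 'I_n).
Implicit Types (i j a b : 'I_n) (eta : 'M[R]_n) (D t : 'I_n -> R) (s : 'rV[R]_n).
Local Notation par := (parent r).
Local Notation pivot := (pivot r).
Local Notation slope := (slope r).
Local Notation pivotal := (pivotal r).

Let idx (k : nat) : 'I_n := insubd r k.-1.

Let val_idx k : (0 < k <= n)%N -> idx k = k.-1 :> nat.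
Proof.
by move=> kn; rewrite /idx -[LHS]/(val _) val_insubd; case: ifP => //; lia.
Qed.

Lemma index1_ord a : index1 n a.+1 = Some a.
Proof. exact: valK. Qed.

Lemma entry_ord eta a b : entry eta a.+1 b.+1 = eta a b.
Proof. by rewrite /entry !index1_ord. Qed.

Lemma coef_ord s a : coef s a.+1 = s 0 a.
Proof. by rewrite /coef index1_ord. Qed.

Lemma coef0 s : coef s 0 = 0. Proof. by []. Qed.

Lemma coef_ge s k : (n < k)%N -> coef s k = 0.
Proof.
by case: k => // k kn; rewrite /coef /index1 insubF//; apply/negbTE; rewrite -leqNgt.
Qed.

Let entry_idx eta k l : (0 < k <= n)%N -> (0 < l <= n)%N ->
  entry eta k l = eta (idx k) (idx l).
Proof.
move=> kn ln; rewrite -entry_ord !val_idx//.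
by case/andP: kn => k0 _; case/andP: ln => l0 _; rewrite !prednK.
Qed.

Let coef_idx s k : (0 < k <= n)%N -> coef s k = s 0 (idx k).
Proof. by move=> kn; rewrite -coef_ord val_idx// prednK//; case/andP: kn. Qed.

Lemma det2E eta k : det2 eta k =
  entry eta k k * entry eta k.+1 k.+1 - entry eta k k.+1 * entry eta k.+1 k.
Proof.
rewrite /det2 (expand_det_row _ ord0) big_ord_recl big_ord1 /cofactor !det_mx11.
by rewrite !mxE /= !addn0 !addn1 expr0 expr1 mul1r mulN1r mulrN.
Qed.

Lemma pivot_minor eta i : eta (par i) (par i) != 0 -> i != r ->
  pivot eta i * eta (par i) (par i) =
  eta i i * eta (par i) (par i) - eta i (par i) ^+ 2.
Proof.
by move=> ep ir; rewrite /pivot /contrast_form /slope (negbTE ir); field.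
Qed.

Let parent_left k : (0 < k < r.+1)%N -> par (idx k) = idx k.+1.
Proof.
move=> kr; have rn := ltn_ord r; apply: val_inj; rewrite /= val_parent !val_idx; try lia.
by rewrite (_ : (k.-1 < r)%N = true); lia.
Qed.

Let parent_right k : (r.+1 < k <= n)%N -> par (idx k) = idx k.-1.
Proof.
move=> kr; have rn := ltn_ord r; apply: val_inj; rewrite /= val_parent !val_idx; try lia.
rewrite (_ : (k.-1 < r)%N = false); last by lia.
by rewrite (_ : (r < k.-1)%N = true); lia.
Qed.

Let idx_neq k : (0 < k <= n)%N -> (k != r.+1)%N -> idx k != r.
Proof. by move=> kn kr; rewrite -val_eqE /= val_idx//; lia. Qed.

Let idx_root : idx r.+1 = r.
Proof. by rewrite /idx /= valKd. Qed.

Section pivotal_density.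
Variable eta : 'M[R]_n.
Hypothesis pe : pivotal eta.
Let X k := eta (idx k) (idx k).
Let P k := pivot eta (idx k).

Let X0 k : 0 < X k. Proof. exact: pivotal_diag_gt0 pe.2. Qed.
Let P0 k : 0 < P k. Proof. exact: pe.2. Qed.

Let det2_left k : (1 <= k < r.+1)%N -> det2 eta k = P k * X k.+1.
Proof.
move=> kr; have rn := ltn_ord r; rewrite det2E !entry_idx; try lia.
rewrite /P /X -(parent_left kr) pivot_minor ?(IG_sym pe.1 (par _))//.
- by rewrite gt_eqF// (pivotal_diag_gt0 _ pe.2).
- by apply: idx_neq; lia.
Qed.

Let det2_right k : (r.+2 <= k < n.+1)%N -> det2 eta k.-1 = P k * X k.-1.
Proof.
move=> kr; have rn := ltn_ord r; rewrite det2E !entry_idx; try lia.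
rewrite prednK; last by lia.
rewrite /P /X -parent_right; last by lia.
rewrite pivot_minor ?(IG_sym pe.1 (par _)) 1?mulrC//.
- by rewrite gt_eqF// (pivotal_diag_gt0 _ pe.2).
- by apply: idx_neq; lia.
Qed.

Let entry_diag k : (0 < k <= n)%N -> entry eta k k = X k.
Proof. by move=> kn; rewrite entry_idx. Qed.

Let prod_idx (F : 'I_n -> R) : \prod_(i | i != r) F i =
  \prod_(1 <= k < r.+1) F (idx k) * \prod_(r.+2 <= k < n.+1) F (idx k).
Proof.
have rn := ltn_ord r; rewrite big_mkcond.
rewrite (eq_bigr (fun i : 'I_n => (fun k => if idx k.+1 != r then F (idx k.+1) else 1) i)); last first.
  by move=> i _ /=; rewrite /idx /= valKd.
rewrite -(big_mkord xpredT (fun k => if idx k.+1 != r then F (idx k.+1) else 1)).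
rewrite -(big_add1 _ _ 0 n.+1 xpredT (fun k => if idx k != r then F (idx k) else 1)).
rewrite (@big_cat_nat _ _ _ r.+1)//=; last by lia.
rewrite [X in _ * X]big_ltn// idx_root eqxx mul1r.
by congr (_ * _); apply: eq_big_nat => k kr; rewrite idx_neq//; lia.
Qed.

Let delta_ranges s : delta r.+1 s eta =
  \prod_(1 <= k < r.+1) P k `^ coef s k *
  \prod_(r.+2 <= k < n.+1) P k `^ coef s k * X r.+1 `^ coef s r.+1.
Proof.
have rn := ltn_ord r.
rewrite -(@delta_telescope _ _ _ _ r.+1 n rn (coef0 s) (coef_ge s (ltnSn n)) X0 P0).
rewrite /delta entry_diag; last by lia.
congr (_ * _ / (_ * _ * _)); apply: eq_big_nat => k kr.
- by rewrite det2_left.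
- by rewrite det2_right.
- by rewrite entry_diag//; lia.
- by rewrite entry_diag//; lia.
Qed.

(** Each minor is the pivot of the child times the diagonal entry of the parent,
    and the diagonal entries cancel, except at the root, where the diagonal entry
    is the pivot. *)
Lemma delta_pivot s : delta r.+1 s eta = \prod_i pivot eta i `^ s 0 i.
Proof.
rewrite delta_ranges [RHS](bigD1 r)//= [RHS]mulrC prod_idx pivot_root.
rewrite /X idx_root coef_ord.
congr (_ * _ * _); apply: eq_big_nat => k kr; rewrite /P coef_idx//.
  by have := ltn_ord r; lia.
by lia.
Qed.

Let phi_ranges : phi eta =
  \prod_(1 <= k < r.+1) (P k `^ (- (3 / 2)) * X k.+1 `^ (- 2^-1)) *
  \prod_(r.+2 <= k < n.+1) (P k `^ (- (3 / 2)) * X k.-1 `^ (- 2^-1)) / X r.+1.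
Proof.
have rn := ltn_ord r; rewrite /phi; case: eqP => [n1|n1].
  by rewrite entry_diag ?n1// !big_geq; [|lia..]; rewrite !mul1r; congr (X _)^-1; lia.
rewrite -phi_telescope//; [|lia..].
rewrite (@big_cat_nat _ _ _ r.+1)//=.
congr (_ * _ * _); last by apply: eq_big_nat => k kr; rewrite entry_diag//; lia.
  by apply: eq_big_nat => k kr; rewrite det2_left.
by rewrite [RHS]big_add1 /=; apply: eq_big_nat => k kr; rewrite -det2_right//; lia.
Qed.

(** The power [- 2^-1] of the parent entry that remains on each edge is the one
    that normalises the Gaussian integral over the entry of the edge. *)
Lemma delta_phi_pivot s : delta r.+1 s eta * phi eta =
  \prod_(i | i != r) (pivot eta i `^ (s 0 i - 3 / 2) *
     eta (par i) (par i) `^ (- 2^-1)) * eta r r `^ (s 0 r - 1).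
Proof.
have rn := ltn_ord r; rewrite delta_ranges phi_ranges prod_idx.
have XS : X r.+1 `^ coef s r.+1 / X r.+1 = eta r r `^ (s 0 r - 1).
  rewrite /X idx_root coef_ord powRD.
    by rewrite powR_inv1 ?ltW// -idx_root; exact: X0.
  by rewrite -idx_root (gt_eqF (X0 _)) implybT.
rewrite -XS.
have PS (k : nat) u : (0 < k <= n)%N ->
    P k `^ coef s k * (P k `^ (- (3 / 2)) * u) =
    pivot eta (idx k) `^ (s 0 (idx k) - 3 / 2) * u.
  move=> kn; rewrite mulrA -powRD; last by rewrite (gt_eqF (P0 _)) implybT.
  by rewrite coef_idx.
transitivity (\prod_(1 <= k < r.+1) (P k `^ coef s k * (P k `^ (- (3 / 2)) * X k.+1 `^ (- 2^-1))) *
  \prod_(r.+2 <= k < n.+1) (P k `^ coef s k * (P k `^ (- (3 / 2)) * X k.-1 `^ (- 2^-1))) *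
  (X r.+1 `^ coef s r.+1 / X r.+1)).
  by rewrite !big_split/=; ring.
congr (_ * _ * _); apply: eq_big_nat => k kr; rewrite PS; try lia.
- by rewrite /X -parent_left.
- by rewrite /X -parent_right//; lia.
Qed.

End pivotal_density.

End density_coordinates.

(** * The total mass of the density *)

Section total_mass.
Variables (R : realType) (n : nat) (r : 'I_n.+1).
Implicit Types (i j a b : 'I_n.+1) (eta : 'M[R]_n.+1) (D t : 'I_n.+1 -> R).
Implicit Types s : 'rV[R]_n.+1.
Local Notation mu := (@lebesgue_measure R).
Local Notation RT := (measurableTypeR R).
Local Notation par := (parent r).
Local Notation pivot := (pivot r).
Local Notation slope := (slope r).
Local Notation pivotal := (pivotal r).

Definition vertex_factor s D t eta i : R :=
  edge_kernel (s 0 i - 3 / 2) (D i) (t i) (eta i i) (eta i (par i))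
    (eta (par i) (par i)).

(** The unnormalised density, extended by zero from the pivotal matrices to [IG]
    in a form that splits into a chain of kernels; see [weight_pivotal] and
    [weight_not_pivotal]. *)
Definition weight s D t eta : R :=
  \prod_(i | i != r) vertex_factor s D t eta i *
  gamma_density (s 0 r - 1) (D r) (eta r r).

Lemma weight_ge0 s D t eta : 0 <= weight s D t eta.
Proof.
rewrite mulr_ge0 ?gamma_density_ge0// prodr_ge0// => i _.
exact: edge_kernel_ge0.
Qed.

Lemma weight_pivotal s D t eta : t r = 0 -> pivotal eta ->
  weight s D t eta =
  expR (- pairing (coordmx r D t) eta) * delta r.+1 s eta * phi eta.
Proof.
move=> tr pe; have [eI p0] := pe; have d0 i := pivotal_diag_gt0 i p0.
rewrite -mulrA delta_phi_pivot// pairing_coordmx// -sumrN expR_sum.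
have vE : \prod_(i | i != r) vertex_factor s D t eta i =
    \prod_(i | i != r) expR (- (D i * contrast_form r t i eta)) *
    \prod_(i | i != r) (pivot eta i `^ (s 0 i - 3 / 2) *
      eta (par i) (par i) `^ (- 2^-1)).
  rewrite -big_split/=; apply: eq_bigr => i ir.
  rewrite /vertex_factor /edge_kernel d0 /gamma_density.
  have -> : - (D i * contrast_form r t i eta) = - (D i * pivot eta i) -
      D i / eta (par i) (par i) * (eta i (par i) - t i * eta (par i) (par i)) ^+ 2.
    rewrite contrast_form_pivot ?gt_eqF// /slope (negbTE ir).
    by field; rewrite gt_eqF.
  by rewrite -pivot_sub// p0 expRD; ring.
have rE : gamma_density (s 0 r - 1) (D r) (eta r r) =
    eta r r `^ (s 0 r - 1) * expR (- (D r * contrast_form r t r eta)).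
  rewrite /gamma_density d0; congr (_ * expR (- (_ * _))).
  by rewrite contrast_form_pivot// ?gt_eqF// tr /slope eqxx pivot_root; ring.
by rewrite /weight vE rE [X in _ = X * _](bigD1 r)//=; ring.
Qed.

Lemma weight_not_pivotal s D t eta : IG eta -> ~ pivotal eta ->
  weight s D t eta = 0.
Proof.
move=> eI npe; apply: contra_notP npe => /eqP.
rewrite mulf_eq0 negb_or => /andP[/prodf_neq0 w0 g0].
split=> // i; have [->|ir] := eqVneq i r.
  by move: g0; rewrite pivot_root /gamma_density; case: ifP; rewrite ?eqxx.
have := w0 i ir; rewrite /vertex_factor /edge_kernel.
case: ifP => [x0|]; last by rewrite eqxx.
rewrite -pivot_sub// /gamma_density; case: ifP => //.
by rewrite !mul0r eqxx.
Qed.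

Let child (k : nat) : 'I_n.+1 := inord (if (k < r)%N then k else k.+1).

Let childE (k : 'I_n) : child k = lift r k.
Proof.
apply: val_inj; have kn := ltn_ord k; rewrite /= /child inordK; last by case: ifP; lia.
by rewrite /bump; case: ltnP; lia.
Qed.

Let prod_child (F : 'I_n.+1 -> R) :
  \prod_(i | i != r) F i = \prod_(k < n) F (child k).
Proof.
rewrite big_mkcond (bigD1_ord r)//= eqxx mul1r; apply: eq_bigr => k _.
by rewrite childE eq_sym neq_lift.
Qed.

(** The edge [k] joins the vertices [k] and [k.+1]; its child is the first of them
    to the left of the root and the second to the right, where the two vertex
    arguments are exchanged accordingly. *)
Definition path_kernel s D t (k : nat) (a b x : RT) : R :=
  let i := child k in
  if (k < r)%N then edge_kernel (s 0 i - 3 / 2) (D i) (t i) a b x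
  else edge_kernel (s 0 i - 3 / 2) (D i) (t i) x b a.

Lemma path_kernel_chain s D t : chain_kernel (path_kernel s D t).
Proof.
split=> [k a b x|k|k a b x].
- by rewrite /path_kernel; case: ifP => _; exact: edge_kernel_ge0.
- have m1 : measurable_fun setT (fun w : RT * RT * RT => w.1.1).
    exact: (measurableT_comp measurable_fst measurable_fst).
  have m2 : measurable_fun setT (fun w : RT * RT * RT => w.1.2).
    exact: (measurableT_comp measurable_snd measurable_fst).
  by rewrite /path_kernel; case: (k < r)%N; exact: measurable_edge_kernel.
- move=> ax0; have E p d tt u v w : ~~ ((0 < u) && (0 < w)) ->
      @edge_kernel R p d tt u v w = 0.
    rewrite /edge_kernel; case: ifP => [w0|]//; rewrite andbT /gamma_density => u0.
    rewrite ifF ?mul0r//; apply: contraNF u0; rewrite subr_gt0 => uv.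
    by apply: le_lt_trans uv; rewrite divr_ge0 ?sqr_ge0 ?ltW.
  by rewrite /path_kernel; case: ifP => _; apply: E; rewrite // andbC.
Qed.

Lemma weight_chart s D t (p : n.+1.-tuple RT * n.-tuple RT) :
  weight s D t (IG_chart p) =
  chain n (path_kernel s D t) p.1 p.2 *
    gamma_density (s 0 r - 1) (D r) (nth 0 p.1 r).
Proof.
have diag i : IG_chart p i i = nth 0 p.1 i by rewrite mxE eqxx (tnth_nth 0).
have off i j : edge i j -> i != j -> IG_chart p i j = nth 0 p.2 (minn i j).
  by move=> eij ij; rewrite mxE (negbTE ij) eij.
rewrite /weight diag; congr (_ * _).
rewrite prod_child; apply: eq_bigr => k _; rewrite /vertex_factor !diag.
have lr : child k != r by rewrite childE eq_sym neq_lift.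
rewrite off ?edge_parent// 1?eq_sym ?parent_neq//.
have kn := ltn_ord k.
rewrite /path_kernel val_parent /child; case: (ltnP k r) => kr.
  by rewrite inordK ?kr; [rewrite (minn_idPl _)|lia].
rewrite inordK; last by lia.
rewrite (_ : (k.+1 < r)%N = false); last by lia.
by rewrite ltnS kr (minn_idPr _).
Qed.

Lemma integral_path_kernel (p d tt x : R) : 0 < d -> 0 < x -> -1 < p ->
  (\int[mu]_a \int[mu]_b (edge_kernel p d tt a b x)%:E =
   (d `^ (- (p + 1 + 2^-1)) * (Num.sqrt pi * fine (gamma_integral p 1)))%:E)%E.
Proof.
move=> d0 x0 p1.
rewrite (fubini_tonelli (fun w : RT * RT => (edge_kernel p d tt w.1 w.2 x)%:E)).
- rewrite /= integral_edge_kernel// EFinM; congr (_ * _)%E; rewrite EFinM fineK//.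
  by rewrite ge0_fin_numE ?gamma_integral_lty// ltW// gamma_integral_gt0.
- by apply/measurable_EFinP; exact: measurable_edge_kernel.
- by move=> w; rewrite lee_fin edge_kernel_ge0.
Qed.

Lemma measurable_entry i j : measurable_fun setT (fun eta => eta i j : RT).
Proof. exact: measurable_mx_entry. Qed.

Lemma measurable_weight s D t : measurable_fun setT (fun eta => weight s D t eta : RT).
Proof.
apply: measurable_funM.
  under eq_fun do rewrite big_mkcond.
  apply: measurable_prod => i _; case: (i != r) => //.
  by apply: measurable_edge_kernel; exact: measurable_entry.
apply: (measurableT_comp (measurable_gamma_density _ _)); exact: measurable_entry.
Qed.

Lemma integral_lebesgue_IG (f : 'M[R]_n.+1 -> \bar R) :
  measurable_fun setT f -> (forall eta, 0 <= f eta)%E ->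
  (\int[@lebesgue_IG R n.+1]_eta f eta =
   \int[@lebesgue_tuple R n.+1]_t \int[@lebesgue_tuple R n]_u
     f (IG_chart ((t, u) : n.+1.-tuple RT * n.+1.-1.-tuple RT)))%E.
Proof.
move=> mf f0; have mc := @measurable_IG_chart R n.+1.
transitivity (\int[pushforward (lebesgue_tuple R n.+1 \x lebesgue_tuple R n.+1.-1)
  (@IG_chart R n.+1)]_eta f eta)%E; first by [].
rewrite (ge0_integral_pushforward mc) ?preimage_setT//.
have mfc : measurable_fun setT (f \o @IG_chart R n.+1) by exact: (measurableT_comp mf mc).
exact: (@fubini_tonelli1 _ _ _ _ _ (lebesgue_tuple R n.+1)
  (lebesgue_tuple R n.+1.-1) _ mfc (fun p => f0 (IG_chart p))).
Qed.

(** Every edge contributes [D i `^ (- s i)], and so does the gamma density at the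
    root; the slopes [t] only translate the Gaussians. *)
Lemma integral_weight s :
  (forall i, i != r -> 1 / 2 < s 0 i) -> 0 < s 0 r ->
  exists2 C : R, 0 < C & forall D t, (forall i, 0 < D i) ->
    (\int[@lebesgue_IG R n.+1]_eta (weight s D t eta)%:E =
     (C * \prod_i D i `^ (- s 0 i))%:E)%E.
Proof.
move=> hs hr.
pose cst i : R := Num.sqrt pi * fine (gamma_integral (s 0 i - 3 / 2) 1).
have fin (p : R) : -1 < p -> gamma_integral p 1 \is a fin_num.
  by move=> p1; rewrite ge0_fin_numE ?gamma_integral_lty// ltW// gamma_integral_gt0.
have gpos (p : R) : -1 < p -> 0 < fine (gamma_integral p 1).
  by move=> p1; rewrite fine_gt0// gamma_integral_gt0 gamma_integral_lty.
have hs' i : i != r -> -1 < s 0 i - 3 / 2 by move=> /hs; lra.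
have hr' : -1 < s 0 r - 1 by lra.
exists (\prod_(i | i != r) cst i * fine (gamma_integral (s 0 r - 1) 1)).
  rewrite mulr_gt0 ?gpos// prodr_gt0// => i ir.
  by rewrite mulr_gt0 ?gpos ?hs'// sqrtr_gt0 pi_gt0.
move=> D t D0; pose K := path_kernel s D t.
pose c k : R := D (child k) `^ (- s 0 (child k)) * cst (child k).
have childr k : (k < n)%N -> child k != r.
  move=> kn; rewrite -val_eqE /= /child inordK; case: ifP => kr; lia.
have Ksub k (x : R) : (k < n)%N -> 0 < x ->
  (\int[mu]_a \int[mu]_b
    (edge_kernel (s 0 (child k) - 3 / 2) (D (child k)) (t (child k)) a b x)%:E = (c k)%:E)%E.
  move=> kn x0; rewrite integral_path_kernel ?hs' ?childr//.
  by rewrite /c /cst; congr ((_ `^ _ * _)%:E); lra.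
have mW := measurable_weight s D t.
have W0 eta : (0 <= (weight s D t eta)%:E)%E by rewrite lee_fin weight_ge0.
have mg := measurable_gamma_density (s 0 r - 1) (D r).
transitivity (\int[@lebesgue_tuple R n.+1]_tt \int[@lebesgue_tuple R n]_u
    (chain n K tt u * gamma_density (s 0 r - 1) (D r) (nth 0 tt r))%:E)%E.
  have mWe : measurable_fun setT (fun eta => (weight s D t eta)%:E).
    exact/measurable_EFinP.
  rewrite (integral_lebesgue_IG mWe W0).
  by apply: eq_integral => tt _; apply: eq_integral => u _; rewrite weight_chart.
rewrite (@integral_chain R n r K c _ (gamma_integral (s 0 r - 1) (D r)))//.
- rewrite gamma_integral_scale// -[gamma_integral _ 1]fineK ?fin//.
  rewrite -!EFinM; congr EFin; rewrite [\prod_i D i `^ _](bigD1 r)//=.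
  by rewrite !prod_child /c big_split/= subrK; ring.
- exact: path_kernel_chain.
- by rewrite -ltnS.
- move=> k x kr x0; have kn : (k < n)%N by have := ltn_ord r; lia.
  rewrite -(Ksub k x kn x0).
  by rewrite /K /path_kernel kr.
- move=> k x /andP[rk kn] x0; rewrite -(Ksub k x kn x0).
  by rewrite /K /path_kernel ltnNge rk.
- by move=> x; exact: gamma_density_ge0.
- by move=> x x0; rewrite /gamma_density (negbTE x0).
Qed.

End total_mass.

(** * Measures given by a density *)

Section density_measure.
Context d (T : measurableType d) (R : realType).
Variables (mu P : {measure set T -> \bar R}) (w : T -> R).
Hypotheses (mw : measurable_fun setT w) (w0 : forall x, 0 <= w x).
Hypothesis Pw : forall A, measurable A -> P A = (\int[mu]_(x in A) (w x)%:E)%E.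
Local Open Scope ereal_scope.

Import HBNNSimple.

(** Both sides are additive and continuous along increasing sequences, so simple
    functions decide. *)
Lemma ge0_integral_density (f : T -> \bar R) : measurable_fun setT f ->
  (forall x, 0 <= f x) -> \int[P]_x f x = \int[mu]_x (f x * (w x)%:E).
Proof.
have mwe : measurable_fun setT (EFin \o w) by exact/measurable_EFinP.
move=> mf f0; pose f_ := nnsfun_approx measurableT mf.
have f_cvg x : (EFin \o f_ ^~ x) n @[n --> \oo] --> f x.
  exact: (cvg_nnsfun_approx measurableT mf (fun x _ => f0 x)).
transitivity (limn (fun n => \int[P]_x (f_ n x)%:E)).
  rewrite -monotone_convergence//.
  - by apply: eq_integral => y _; apply/esym/cvg_lim => //; exact: f_cvg.
  - by move=> n; exact/measurable_EFinP/measurable_funP.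
  - by move=> n y _; rewrite lee_fin.
  - by move=> y _ m n mn; rewrite lee_fin; exact/lefP/nd_nnsfun_approx.
rewrite [X in limn X](_ : _ = (fun n => \int[mu]_x ((f_ n x)%:E * (w x)%:E))).
  rewrite -monotone_convergence//; last 3 first.
  - move=> n; apply: emeasurable_funM => //.
    exact/measurable_EFinP/measurable_funP.
  - by move=> n x _; rewrite mule_ge0// lee_fin.
  - move=> x _ m n mn; rewrite lee_wpmul2r ?lee_fin//.
    exact/lefP/nd_nnsfun_approx.
  apply: eq_integral => x _; apply/cvg_lim => //.
  by apply: cvgeZr => //; exact: f_cvg.
apply/funext => n.
transitivity (\sum_(k \in range (f_ n)) (k%:E * P (f_ n @^-1` [set k]))).
  under eq_integral do rewrite fimfunE -fsumEFin//.
  rewrite ge0_integral_fsum//; last 2 first.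
  - by move=> y; exact/measurable_EFinP/measurable_funM.
  - by move=> y x _; rewrite nnfun_muleindic_ge0.
  by apply: eq_fsbigr => r _; rewrite integralZl_indic_nnsfun// integral_indic//= setIT.
transitivity (\int[mu]_x (\sum_(k \in range (f_ n))
    ((k * \1_(f_ n @^-1` [set k]) x)%:E * (w x)%:E))).
  rewrite ge0_integral_fsum//; last 2 first.
  - move=> y; apply: emeasurable_funM => //.
    by exact/measurable_EFinP/measurable_funM.
  - move=> y x _; apply: mule_ge0; last by rewrite lee_fin.
    by rewrite EFinM nnfun_muleindic_ge0.
  apply: eq_fsbigr => r; rewrite inE => -[z _ <-].
  rewrite Pw// integral_mkcond.
  rewrite -(ge0_integralZl _ measurableT) => [||x _|]; last 3 first.
  - have mfr : measurable (f_ n @^-1` [set f_ n z]) by exact: measurable_funPTI.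
    by apply: (measurable_restrictT _ mfr).1; exact: measurable_funTS.
  - by rewrite patchE; case: ifP => // _; rewrite lee_fin.
  - by rewrite lee_fin.
  apply: eq_integral => x _; rewrite EFinM -muleA patchE indicE.
  by case: ifP => _; rewrite ?mul1e ?mul0e.
apply: eq_integral => x _; rewrite -ge0_mule_fsuml.
  by rewrite fsumEFin// -fimfunE.
by move=> r; rewrite EFinM nnfun_muleindic_ge0.
Qed.

End density_measure.

Section density_probability.
Context d (T : measurableType d) (R : realType).
Variables (mu : {measure set T -> \bar R}) (w : T -> R).

Lemma density_probability : measurable_fun setT w -> (forall x, 0 <= w x) ->
  (\int[mu]_x (w x)%:E = 1)%E ->
  exists P : probability T R, forall A, P A = (\int[mu]_(x in A) (w x)%:E)%E.
Proof.
move=> mw w0 w1; pose nu A := (\int[mu]_(x in A) (w x)%:E)%E.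
have nu0 : nu set0 = 0%E by rewrite /nu integral_set0.
have nu_ge0 A : (0 <= nu A)%E by apply: integral_ge0 => x _; rewrite lee_fin.
have nu_sigma : semi_sigma_additive nu.
  move=> /= F mF tF mUF; apply: cvg_toP.
    apply: ereal_nondecreasing_is_cvgn => m n mn.
    by apply: lee_sum_nneg_natr => // k _ _; exact: nu_ge0.
  rewrite /nu ge0_integral_bigcup//=.
  - by apply: measurable_funTS; exact/measurable_EFinP.
  - by move=> x _; rewrite lee_fin.
pose nu_measure := isMeasure.Build _ T R nu nu0 nu_ge0 nu_sigma.
pose nuM : {measure set T -> \bar R} := HB.pack nu nu_measure.
pose nu_prob := Measure_isProbability.Build _ T R nuM w1.
pose nuP : probability T R := HB.pack nu nu_measure nu_prob.
by exists nuP.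
Qed.

End density_probability.


(** * The mean of the Wishart distribution *)

Section wishart_moments.
Variables (R : realType) (n : nat) (r : 'I_n.+1) (s : 'rV[R]_n.+1).
Hypothesis hs : forall i, i != r -> 1 / 2 < s 0 i.
Hypothesis hr : 0 < s 0 r.
Implicit Types (i j a b : 'I_n.+1) (eta : 'M[R]_n.+1) (D t : 'I_n.+1 -> R).
Local Notation mu := (@lebesgue_IG R n.+1).
Local Notation RT := (measurableTypeR R).
Local Notation par := (parent r).
Local Notation pivot := (pivot r).
Local Notation slope := (slope r).
Local Notation pivotal := (pivotal r).
Local Notation QGn := (@QG R n.+1).

Lemma measurable_pivot i : measurable_fun setT (fun eta => pivot eta i : RT).
Proof.
have [->|ir] := eqVneq i r.
  by under eq_fun do rewrite pivot_root; exact: measurable_entry.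
under eq_fun do rewrite pivot_sub//.
apply: measurable_funB; first exact: measurable_entry.
apply: measurable_funM; first by apply: measurable_funX; exact: measurable_entry.
by apply: (measurableT_comp (@measurable_inv R)); exact: measurable_entry.
Qed.

Lemma measurable_QG : measurable QGn.
Proof.
have meq (f : 'M[R]_n.+1 -> RT) : measurable_fun setT f ->
    measurable [set eta | f eta = 0].
  move=> mf; rewrite (_ : [set eta | _] = setT `&` f @^-1` [set 0]).
    by apply: mf => //; exact: measurable_set1.
  by rewrite setTI.
pose F (p : 'I_n.+1 * 'I_n.+1) : set 'M[R]_n.+1 :=
  [set eta | eta p.2 p.1 - eta p.1 p.2 = 0] `&`
  [set eta | (~~ edge p.1 p.2)%:R * eta p.1 p.2 = 0].
pose G i : set 'M[R]_n.+1 := [set eta | 0 < pivot eta i].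
have -> : QGn = (\bigcap_(p in [set: 'I_n.+1 * 'I_n.+1]) F p) `&` \bigcap_(i in setT) G i.
  apply/seteqP; split => [eta /(QG_pivotal r)[eI p0]|eta [eF eG]].
    split=> [[a b] _|i _]; last exact: p0.
    split=> /=; first by rewrite (IG_sym eI) subrr.
    by case: (boolP (edge a b)) => ab; rewrite ?mul0r// eI.2// mulr0.
  apply/(QG_pivotal r); split=> [|i]; last exact: (eG i).
  split=> [|a b ab]; last by have [_ /=] := eF (a, b) I; rewrite ab mul1r.
  apply/matrixP => a b; rewrite mxE.
  by have [/= /eqP + _] := eF (a, b) I; rewrite subr_eq0 => /eqP.
apply: measurableI; apply: fin_bigcap_measurable => //.
- move=> p _; apply: measurableI; apply: meq.
    by apply: measurable_funB; exact: measurable_entry.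
  by apply: measurable_funM => //; exact: measurable_entry.
- move=> i _; rewrite /G (_ : [set eta | _] =
    setT `&` (fun eta => pivot eta i : RT) @^-1` `]0, +oo[%classic).
    by apply: measurable_pivot => //; exact: measurable_itv.
  by rewrite setTI; apply/seteqP; split=> eta /=; rewrite in_itv/= andbT.
Qed.

Lemma IG_chart_IG (p : n.+1.-tuple RT * n.+1.-1.-tuple RT) : IG (IG_chart p).
Proof.
split=> [|a b ab].
  apply/matrixP => a b; rewrite !mxE eq_sym; case: eqP => [->//|_].
  by rewrite (_ : edge b a = edge a b) 1?minnC// /edge andbC.
rewrite mxE (negbTE ab); case: eqP => // ab'.
by move: ab; rewrite ab' /edge leqnSn.
Qed.

Lemma eq_integral_IG (f g : 'M[R]_n.+1 -> \bar R) :
  measurable_fun setT f -> (forall eta, 0 <= f eta)%E ->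
  measurable_fun setT g -> (forall eta, 0 <= g eta)%E ->
  (forall eta, IG eta -> f eta = g eta) ->
  (\int[mu]_eta f eta = \int[mu]_eta g eta)%E.
Proof.
move=> mf f0 mg g0 fg; rewrite (integral_lebesgue_IG mf f0).
rewrite (integral_lebesgue_IG mg g0).
by do 2 (apply: eq_integral => ? _); apply: fg; exact: IG_chart_IG.
Qed.

(** On [IG] the weight already vanishes off [QG]; the indicator function makes it
    do so on all matrices. *)
Definition wishart_weight D t eta : R := weight r s D t eta * \1_QGn eta.

Lemma wishart_weight_ge0 D t eta : 0 <= wishart_weight D t eta.
Proof. by rewrite mulr_ge0// weight_ge0. Qed.

Lemma measurable_wishart_weight D t :
  measurable_fun setT (fun eta => wishart_weight D t eta : RT).
Proof.
apply: measurable_funM; first exact: measurable_weight.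
exact: measurable_indic measurable_QG.
Qed.

Lemma wishart_weightE D t eta : t r = 0 -> wishart_weight D t eta =
  expR (- pairing (coordmx r D t) eta) * delta r.+1 s eta * phi eta * \1_QGn eta.
Proof.
move=> tr; rewrite /wishart_weight indicE.
have [eQ|] := boolP (eta \in QGn); last by rewrite !mulr0.
by rewrite weight_pivotal//; apply/QG_pivotal; rewrite inE in eQ.
Qed.

Lemma integral_wishart_weight : exists2 C : R, 0 < C &
  forall D t, (forall i, 0 < D i) ->
    (\int[mu]_eta (wishart_weight D t eta)%:E =
     (C * \prod_i D i `^ (- s 0 i))%:E)%E.
Proof.
have [C C0 HC] := integral_weight hs hr; exists C => // D t D0.
rewrite -(HC D t D0); apply: eq_integral_IG.
- by apply/measurable_EFinP; exact: measurable_wishart_weight.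
- by move=> eta; rewrite lee_fin wishart_weight_ge0.
- by apply/measurable_EFinP; exact: measurable_weight.
- by move=> eta; rewrite lee_fin weight_ge0.
move=> eta eI; rewrite /wishart_weight indicE.
have [eQ|eQ] := boolP (eta \in QGn); first by rewrite mulr1.
rewrite mulr0 weight_not_pivotal// => pe; move/negP : eQ; apply.
by apply: mem_set; apply/(QG_pivotal r).
Qed.

Section fixed_parameter.
Variables (D t : 'I_n.+1 -> R).
Hypotheses (D0 : forall i, 0 < D i) (tr : t r = 0).
Let y := coordmx r D t.

Lemma is_wishart_weight c A :
  (\int[mu]_(eta in A `&` QGn)
    (c * (expR (- pairing y eta) * delta r.+1 s eta * phi eta))%:E =
   \int[mu]_(eta in A) (c * wishart_weight D t eta)%:E)%E.
Proof.
rewrite integral_mkcond [RHS]integral_mkcond; apply: eq_integral => eta _.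
rewrite !patchE in_setI wishart_weightE// indicE.
by case: (eta \in A) => //=; case: (eta \in QGn); rewrite ?mulr1 ?mulr0.
Qed.

Lemma wishart_mass : exists2 L : R, 0 < L &
  (\int[mu]_eta (wishart_weight D t eta)%:E = L%:E)%E.
Proof.
have [C C0 HC] := integral_wishart_weight; exists (C * \prod_i D i `^ (- s 0 i)).
  by rewrite mulr_gt0// prodr_gt0// => i _; rewrite powR_gt0.
exact: HC.
Qed.

(** The total mass determines the normalising constant. *)
Lemma wishart_density (P : probability 'M[R]_n.+1 R) L : 0 < L ->
  (\int[mu]_eta (wishart_weight D t eta)%:E = L%:E)%E ->
  is_wishart r.+1 s y P ->
  forall A, measurable A ->
    P A = (\int[mu]_(eta in A) (wishart_weight D t eta / L)%:E)%E.
Proof.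
move=> L0 WE [c Pc] A mA; rewrite Pc// is_wishart_weight.
suff -> : c = L^-1 by apply: eq_integral => eta _; rewrite mulrC.
have mWe : measurable_fun setT (EFin \o wishart_weight D t).
  by apply/measurable_EFinP; exact: measurable_wishart_weight.
have iW : mu.-integrable setT (EFin \o wishart_weight D t).
  apply/integrableP; split=> //.
  under eq_integral => eta _ do rewrite /= ger0_norm ?wishart_weight_ge0//.
  by rewrite WE ltry.
have := Pc setT measurableT; rewrite is_wishart_weight probability_setT.
under eq_integral => eta _ do rewrite EFinM.
rewrite integralZl// WE -EFinM => /eqP; rewrite eqe => /eqP cL.
by apply: (mulIf (lt0r_neq0 L0)); rewrite -cL mulVf// lt0r_neq0.
Qed.

Lemma exists_wishart : exists P : pprobability 'M[R]_n.+1 R, is_wishart r.+1 s y P.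
Proof.
have [L L0 WE] := wishart_mass.
have mW := measurable_wishart_weight D t.
have [||| P PE] := @density_probability _ _ _ mu (fun eta => L^-1 * wishart_weight D t eta).
- exact: measurable_funM.
- by move=> eta; rewrite mulr_ge0 ?wishart_weight_ge0// invr_ge0 ltW.
- under eq_integral => eta _ do rewrite EFinM.
  rewrite ge0_integralZl//.
  + by rewrite WE -EFinM mulVf// lt0r_neq0.
  + exact/measurable_EFinP.
  + by move=> eta _; rewrite lee_fin wishart_weight_ge0.
  + by rewrite lee_fin invr_ge0 ltW.
by exists P, L^-1 => A mA; rewrite is_wishart_weight; exact: PE.
Qed.

Lemma wishartP : is_wishart r.+1 s y (wishart r.+1 s y).
Proof. exact: (getPex exists_wishart). Qed.

Local Notation P := (wishart r.+1 s y).

Lemma expectation_ge0 L (f : 'M[R]_n.+1 -> R) : 0 < L ->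
  (\int[mu]_eta (wishart_weight D t eta)%:E = L%:E)%E ->
  measurable_fun setT (f : _ -> RT) -> (forall eta, QGn eta -> 0 <= f eta) ->
  (\int[P]_(eta in QGn) (f eta)%:E =
   \int[mu]_eta (f eta * (wishart_weight D t eta / L))%:E)%E.
Proof.
move=> L0 WE mf f0; have mW := measurable_wishart_weight D t.
have wL0 eta : 0 <= wishart_weight D t eta / L.
  by rewrite divr_ge0 ?wishart_weight_ge0// ltW.
have mwL : measurable_fun setT (fun eta => wishart_weight D t eta / L : RT).
  exact: measurable_funM.
rewrite integral_mkcond.
rewrite (ge0_integral_density mwL wL0 (wishart_density L0 WE wishartP)); last 2 first.
- apply: (measurable_restrictT _ measurable_QG).1; apply: measurable_funTS.
  exact/measurable_EFinP.
- move=> eta; rewrite patchE; case: ifPn => // eQ; rewrite lee_fin f0//.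
  by rewrite inE in eQ.
apply: eq_integral => eta _; rewrite patchE /wishart_weight indicE.
by case: (eta \in QGn); rewrite ?mulr0 ?mul0r ?mulr0 ?mule0// EFinM.
Qed.

Lemma measurable_pairing (z : 'M[R]_n.+1) :
  measurable_fun setT (fun eta => pairing z eta : RT).
Proof.
rewrite /pairing /mxtrace; apply: measurable_sum => a.
under eq_fun do rewrite mxE; apply: measurable_sum => b.
by apply: measurable_funM => //; exact: measurable_entry.
Qed.

(** Tilting the density changes the parameter, so exponential moments are
    ratios of normalising constants. *)
Lemma wishart_laplace D' t' : (forall i, 0 < D' i) -> t' r = 0 ->
  (\int[P]_(eta in QGn)
     (expR (pairing y eta - pairing (coordmx r D' t') eta))%:E =
   ((\prod_i D' i `^ (- s 0 i)) / \prod_i D i `^ (- s 0 i))%:E)%E.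
Proof.
move=> D'0 t'r; have [C C0 HC] := integral_wishart_weight.
have WE := HC D t D0; have WE' := HC D' t' D'0.
set L := \prod_i D i `^ _ in WE *; set L' := \prod_i D' i `^ _ in WE' *.
have L0 : 0 < L by rewrite prodr_gt0// => i _; rewrite powR_gt0.
have CL0 : 0 < C * L by rewrite mulr_gt0.
rewrite (expectation_ge0 CL0 WE); last 2 first.
- apply: measurableT_comp => //.
  by apply: measurable_funB; exact: measurable_pairing.
- by move=> eta _; exact: expR_ge0.
transitivity (\int[mu]_eta ((C * L)^-1%:E * (wishart_weight D' t' eta)%:E))%E.
  apply: eq_integral => eta _; rewrite !wishart_weightE// -EFinM; congr EFin.
  rewrite mulrA [RHS]mulrC; congr (_ / _).
  by rewrite !mulrA -expRD addrAC subrr add0r.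
have mW' := measurable_wishart_weight D' t'.
rewrite ge0_integralZl//; last 3 first.
- exact/measurable_EFinP.
- by move=> eta _; rewrite lee_fin wishart_weight_ge0.
- by rewrite lee_fin invr_ge0 ltW.
by rewrite WE' -EFinM; congr EFin; field; rewrite !gt_eqF.
Qed.

Lemma integrable_laplace D' t' : (forall i, 0 < D' i) -> t' r = 0 ->
  P.-integrable QGn (fun eta =>
    (expR (pairing y eta - pairing (coordmx r D' t') eta))%:E).
Proof.
move=> D'0 t'r; have mQ := measurable_QG; apply/integrableP; split.
  apply: measurable_funTS; apply/measurable_EFinP; apply: measurableT_comp => //.
  by apply: measurable_funB; exact: measurable_pairing.
under eq_integral => eta _ do rewrite /= ger0_norm ?expR_ge0//.
by rewrite wishart_laplace// ltry.
Qed.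

(** Contrast forms with [t i = 1] and [t i = - 1] are positive. *)
Lemma pivotal_entry_le eta a b : pivotal eta -> `|eta a b| <= eta a a + eta b b.
Proof.
move=> pe; have d0 i := pivotal_diag_gt0 i pe.2.
have [ab|ab] := boolP (edge a b); last first.
  by rewrite pe.1.2// normr0 addr_ge0 ?ltW.
suff H i : `|eta i (par i)| <= eta i i + eta (par i) (par i).
  move: ab; rewrite (edge_parentE r) => /or3P[/eqP<-|/eqP<-//|/eqP<-].
    by rewrite ger0_norm ?ltW// ltrDl.
  by rewrite (IG_sym pe.1) addrC.
have form (e : R) : e ^+ 2 = 1 ->
    0 <= eta i i + eta (par i) (par i) - 2 * e * eta i (par i).
  move=> e2; have [->|ir] := eqVneq i r.
    rewrite parent_root; have := d0 r; move/eqP : e2; rewrite sqrf_eq1.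
    by move=> /orP[/eqP->|/eqP->]; lra.
  have := @contrast_form_gt0 R _ r (fun j => if j == r then 0 else e) i eta _ pe.2.
  rewrite eqxx => /(_ erefl) /ltW; rewrite /contrast_form (negbTE ir) e2.
  by rewrite mul1r addrAC.
have h1 := form 1 (expr1n _ _).
have h2 := form (-1) (etrans (sqrrN _) (expr1n _ _)).
have := d0 i; have := d0 (par i); rewrite ler_norml; move: h1 h2; lra.
Qed.

(** Entries are dominated by the pairing, hence by the exponential moment at
    half the parameter. *)
Lemma integrable_entry a b : P.-integrable QGn (fun eta => (eta a b)%:E).
Proof.
have D20 i : 0 < D i / 2 by rewrite divr_gt0.
have [C CC HC] := diag_le_pairing tr D0.
have mQ := measurable_QG.
apply: (@le_integrable _ _ _ P QGn mQ _ (fun eta =>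
   ((4 * C)%:E * (expR (pairing y eta - pairing (coordmx r (fun i => D i / 2) t) eta))%:E)%E)).
- by apply: measurable_funTS; apply/measurable_EFinP; exact: measurable_entry.
- move=> eta eQ; have pe : pivotal eta by apply/QG_pivotal.
  rewrite -EFinM !abse_EFin lee_fin.
  set q := pairing y eta; set e := expR _.
  have qE : pairing (coordmx r (fun i => D i / 2) t) eta = q / 2.
    rewrite /q /y !(@pairing_coordmx R n.+1 r _ _ _ pe.1) mulr_suml; apply: eq_bigr => i _.
    by rewrite mulrAC.
  have eq : q <= 2 * e.
    have := expR_ge1Dx (q - q / 2); rewrite /e qE => h.
    by move: h; lra.
  have h1 := pivotal_entry_le a b pe.
  have := HC _ a pe; have := HC _ b pe; rewrite -/y -/q => hb ha.
  have h2 : C * q <= C * (2 * e) by rewrite ler_wpM2l.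
  rewrite [leRHS]ger0_norm; first by lra.
  by rewrite mulr_ge0 ?expR_ge0// mulr_ge0.
- by apply: integrableZl => //; exact: integrable_laplace.
Qed.

Local Notation m := (mean_map r.+1 s y).

Lemma meanE a b : m a b = \int[P]_(eta in QGn) eta a b.
Proof. by rewrite mxE. Qed.

Lemma mean_IG : IG m.
Proof.
split=> [|a b ab]; last first.
  rewrite meanE (_ : (\int[P]_(eta in QGn) _) = \int[P]_(eta in QGn) 0).
    by rewrite Rintegral_cst ?mul0r//; exact: measurable_QG.
  by apply: eq_Rintegral => eta; rewrite inE => -[[_ ->]].
apply/matrixP => a b; rewrite mxE !meanE; apply: eq_Rintegral => eta.
by rewrite inE => -[eI _]; rewrite (IG_sym eI).
Qed.

Let has_mean (f : 'M[R]_n.+1 -> R) v :=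
  P.-integrable QGn (EFin \o f) /\ \int[P]_(eta in QGn) f eta = v.

Let has_mean_sum (I : Type) (l : seq I) (f : I -> 'M[R]_n.+1 -> R) v :
  (forall k, has_mean (f k) (v k)) ->
  has_mean (fun eta => \sum_(k <- l) f k eta) (\sum_(k <- l) v k).
Proof.
move=> fv; have mQ := measurable_QG; elim: l => [|k l [IHi IHv]].
  rewrite big_nil; under eq_fun do rewrite big_nil; split.
    exact: integrable0.
  by rewrite Rintegral_cst ?mul0r.
have [fi vi] := fv k.
rewrite big_cons; under eq_fun do rewrite big_cons; split.
  exact: (integrableD mQ fi IHi).
by rewrite RintegralD// vi IHv.
Qed.

Lemma mean_pairing (z : 'M[R]_n.+1) :
  P.-integrable QGn (fun eta => (pairing z eta)%:E) /\
  \int[P]_(eta in QGn) pairing z eta = pairing z m.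
Proof.
have mQ := measurable_QG.
have pE eta : pairing z eta = \sum_a \sum_b z a b * eta b a.
  by rewrite /pairing /mxtrace; apply: eq_bigr => a _; rewrite mxE.
rewrite pE (_ : pairing z = fun eta => \sum_a \sum_b z a b * eta b a); last first.
  exact/funext.
apply: has_mean_sum => a; apply: has_mean_sum => b; split.
  exact: (integrableZl mQ (z a b) (integrable_entry b a)).
by rewrite RintegralZl ?meanE//; exact: integrable_entry.
Qed.

(** The convexity inequality [exp x >= 1 + x], integrated.  Both sides agree at
    the parameter itself, so that the inequality forces the equality of their
    derivatives there. *)
Lemma mean_tangent D' t' : (forall i, 0 < D' i) -> t' r = 0 ->
  1 + (pairing y m - pairing (coordmx r D' t') m) <=
  (\prod_i D' i `^ (- s 0 i)) / \prod_i D i `^ (- s 0 i).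
Proof.
move=> D'0 t'r; have mQ := measurable_QG.
have [iy my] := mean_pairing y; have [iy' my'] := mean_pairing (coordmx r D' t').
have PQ : (\int[P]_(eta in QGn) 1%:E = 1)%E.
  have := wishart_laplace D0 tr; rewrite divff; last first.
    by rewrite gt_eqF// prodr_gt0// => i _; rewrite powR_gt0.
  by under eq_integral => eta _ do rewrite subrr expR0.
have i1 : P.-integrable QGn (fun=> 1%:E).
  apply/integrableP; split; first exact: measurable_cst.
  by under eq_integral => eta _ do rewrite abse1; rewrite PQ ltry.
have iX := integrableB mQ iy iy'.
rewrite -my -my' -(RintegralB mQ iy iy').
rewrite [X in X + _](_ : 1 = \int[P]_(eta in QGn) 1); last by rewrite /Rintegral PQ.
rewrite -(RintegralD mQ i1 iX).
have -> : (\prod_i D' i `^ (- s 0 i)) / \prod_i D i `^ (- s 0 i) =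
    \int[P]_(eta in QGn) expR (pairing y eta - pairing (coordmx r D' t') eta).
  by rewrite /Rintegral wishart_laplace.
apply: le_Rintegral => //.
- exact: (integrableD mQ i1 iX).
- exact: integrable_laplace.
- by move=> eta _; exact: expR_ge1Dx.
Qed.

(** Only [D i] is varied, by a factor [1 + e]. *)
Lemma mean_form i : D i * contrast_form r t i m = s 0 i.
Proof.
set K := D i * _.
have H e : -1 < e -> 1 - e * K <= (1 + e) `^ (- s 0 i).
  move=> e1; have e0 : 0 < 1 + e by lra.
  pose D' j := if j == i then (1 + e) * D i else D j.
  have D'0 j : 0 < D' j by rewrite /D'; case: ifP => // _; rewrite mulr_gt0.
  have := mean_tangent D'0 tr; rewrite !pairing_coordmx; [|exact: mean_IG..].
  rewrite ![\sum_j _](bigD1 i)//= ![\prod_j _](bigD1 i)//= {1 3}/D' !eqxx.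
  rewrite [X in _ - (_ + X)](eq_bigr (fun j => D j * contrast_form r t j m)); last first.
    by move=> j /negbTE ji; rewrite /D' ji.
  rewrite [X in _ <= _ * X / _](eq_bigr (fun j => D j `^ (- s 0 j))); last first.
    by move=> j /negbTE ji; rewrite /D' ji.
  rewrite powRM ?(ltW e0) ?(ltW (D0 i))//.
  set A := \sum_(_ | _) _; set B := \prod_(_ | _) _.
  have B0 : B != 0 by rewrite gt_eqF// prodr_gt0// => j _; rewrite powR_gt0.
  have Di0 : D i `^ (- s 0 i) != 0 by rewrite gt_eqF// powR_gt0.
  have -> : (1 + e) `^ (- s 0 i) * D i `^ (- s 0 i) * B / (D i `^ (- s 0 i) * B) =
      (1 + e) `^ (- s 0 i) by field; rewrite B0 Di0.
  by rewrite -/K -mulrA -/K; congr (_ <= _); ring.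
(* With [u = 1 + e], both sides agree at [u = 1], so their difference, which is [h]
   up to a constant, is minimal there. *)
pose h (u : R) := u `^ (- s 0 i) + K *: u.
have dh (u : R) : 0 < u -> is_derive u 1 h (- s 0 i * u `^ (- s 0 i - 1) + K *: 1).
  by move=> u0; apply: is_deriveD; exact: is_derive1_powR.
have h1 : is_derive (1 : R) 1 h 0.
  apply: (@derive1_at_min R h 0 2 1) => // [u||u].
  - by rewrite in_itv/= => /andP[u0 _]; have [] := dh u u0.
  - by rewrite in_itv/= ltr01 ltr1n.
  - rewrite in_itv/= => /andP[u0 _].
    have u1 : -1 < u - 1 by lra.
    have := H _ u1; rewrite (_ : 1 + (u - 1) = u); last by ring.
    by rewrite /h powR1 /GRing.scale/=; lra.
have := @derive_val _ _ _ _ _ _ _ (dh 1 ltr01).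
rewrite (@derive_val _ _ _ _ _ _ _ h1) powR1 /GRing.scale/= !mulr1 => /eqP.
by rewrite eq_sym addrC subr_eq0 => /eqP.
Qed.

(** Only [t i] is varied, and the total mass does not depend on it. *)
Lemma mean_slope i : i != r -> m i (par i) = t i * m (par i) (par i).
Proof.
move=> ir; set U := m i (par i) - t i * m (par i) (par i).
set V := m (par i) (par i).
have H e : 0 <= e ^+ 2 * V - 2 * e * U.
  pose t' j := if j == i then t i + e else t j.
  have t'r : t' r = 0 by rewrite /t' eq_sym (negbTE ir).
  have := mean_tangent D0 t'r; rewrite divff; last first.
    by rewrite gt_eqF// prodr_gt0// => j _; rewrite powR_gt0.
  rewrite !pairing_coordmx; [|exact: mean_IG..].
  rewrite ![\sum_j _](bigD1 i)//=.
  rewrite [X in _ - (_ + X)](eq_bigr (fun j => D j * contrast_form r t j m)); last first.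
    by move=> j /negbTE ji; rewrite /contrast_form /t' ji.
  have -> : contrast_form r t' i m = contrast_form r t i m + (e ^+ 2 * V - 2 * e * U).
    by rewrite /contrast_form /t' eqxx /U /V; ring.
  set A := \sum_(_ | _) _; set B := contrast_form r t i m; set q := _ - 2 * e * U.
  by move=> h; rewrite -(pmulr_rge0 _ (D0 i)); move: h; lra.
suff : U = 0 by rewrite /U => /eqP; rewrite subr_eq0 => /eqP.
(* A quadratic in [e] without constant term is nonnegative only if its linear
   coefficient vanishes. *)
have k0 : 0 < `|V| + 1 by rewrite ltr_wpDl.
have := H (U / (`|V| + 1)).
have -> : (U / (`|V| + 1)) ^+ 2 * V - 2 * (U / (`|V| + 1)) * U =
    (U / (`|V| + 1)) ^+ 2 * (V - 2 * (`|V| + 1)) by field; rewrite gt_eqF.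
have Vk : V - 2 * (`|V| + 1) < 0 by have := ler_norm V; lra.
rewrite nmulr_lge0// => Uk; have /eqP : (U / (`|V| + 1)) ^+ 2 = 0.
  by apply/eqP; rewrite eq_le Uk sqr_ge0.
by rewrite sqrf_eq0 mulf_eq0 invr_eq0 (gt_eqF k0) orbF => /eqP.
Qed.

(** The contrast form of the mean at its own slope is its pivot. *)
Lemma mean_coordinates : [/\ pivotal m, forall i, pivot m i = s 0 i / D i &
  forall i, slope m i = t i].
Proof.
have s0 i : 0 < s 0 i.
  by have [->//|ir] := eqVneq i r; have := hs ir; lra.
have formE i : contrast_form r t i m = s 0 i / D i.
  by rewrite -mean_form mulrC mulKf// gt_eqF.
have d0 i : 0 < m i i.
  elim/(@parent_ind _ r): i => [|i ir IHi].
    have := formE r; rewrite /contrast_form tr mulr0 mul0r subr0 expr0n mul0r addr0.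
    by move=> ->; rewrite divr_gt0.
  have := formE i; rewrite /contrast_form mean_slope// => mE.
  have -> : m i i = s 0 i / D i + t i ^+ 2 * m (par i) (par i) by rewrite -mE; ring.
  by rewrite ltr_wpDr ?divr_gt0// mulr_ge0 ?sqr_ge0// ltW.
have slopeE i : slope m i = t i.
  rewrite /slope; have [->//|ir] := eqVneq i r.
  by rewrite mean_slope// mulfK// gt_eqF.
have pivotE i : pivot m i = s 0 i / D i.
  by rewrite -formE /pivot /contrast_form slopeE.
split=> //; split; first exact: mean_IG.
by move=> i; rewrite pivotE divr_gt0.
Qed.

End fixed_parameter.
End wishart_moments.

(** * The gradient and the inverse mean map *)

Lemma is_derive_line (R : realType) (n : nat) (F : 'M[R]_n -> R) (m h : 'M[R]_n) df :
  is_derive (0 : R) 1 (fun e : R => F (e *: h + m)) df -> is_derive m h F df.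
Proof.
set g := fun e : R => F (e *: h + m).
have E : (fun e : R => e^-1 *: ((F \o shift m) (e *: h) - F m)) =
    (fun e : R => e^-1 *: ((g \o shift 0) (e *: 1) - g 0)).
  apply/funext => e; rewrite /g /= /shift/= addr0 scale0r add0r.
  by rewrite [e *: (1 : R)]mulr1.
move=> [dg <-]; split; first by rewrite /derivable E.
by rewrite /derive E.
Qed.

Section gradient.
Variables (R : realType) (n : nat) (r : 'I_n) (s : 'rV[R]_n).
Implicit Types (i j : 'I_n) (m h eta : 'M[R]_n).
Local Notation par := (parent r).
Local Notation pivot := (pivot r).
Local Notation slope := (slope r).
Local Notation pivotal := (pivotal r).

(** The inverse of the mean map, in the form in which it is a gradient. *)
Definition parameter_of_mean m : 'M[R]_n :=
  coordmx r (fun i => s 0 i / pivot m i) (slope m).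

Lemma ln_delta_pivot eta : pivotal eta ->
  ln (delta r.+1 s eta) = \sum_i s 0 i * ln (pivot eta i).
Proof.
move=> pe; rewrite delta_pivot// -[RHS]expRK expR_sum; congr ln.
by apply: eq_bigr => i _; rewrite /powR gt_eqF// pe.2.
Qed.

Lemma is_derive_entry m h i j (e : R) :
  is_derive e 1 (fun e : R => (e *: h + m) i j) (h i j).
Proof.
under eq_fun do rewrite !mxE mulrC.
have -> : (fun e : R => h i j * e + m i j) =
    (h i j \*: (@id R)) + cst (m i j) :> (R -> R) by apply/funext.
apply: is_derive_eq.
by rewrite /GRing.scale/= mulr1 addr0.
Qed.

(** At fixed slopes the pivot is linear in the matrix, and the pivot is
    stationary in the slopes, whence its derivative. *)
Lemma is_derive_pivot m h i : pivotal m ->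
  is_derive (0 : R) 1 (fun e : R => pivot (e *: h + m) i) (contrast_form r (slope m) i h).
Proof.
move=> pm; have d0 j := pivotal_diag_gt0 j pm.2.
have [->|ir] := eqVneq i r.
  under eq_fun do rewrite pivot_root.
  rewrite /contrast_form slope_root mulr0 mul0r subr0 expr0n mul0r addr0.
  exact: is_derive_entry.
under eq_fun do rewrite pivot_sub// expr2.
have x0 : (0 *: h + m) (par i) (par i) != 0 by rewrite scale0r add0r gt_eqF.
have di := is_derive_entry m h i (par i) 0.
have dV := is_deriveV x0 (is_derive_entry m h (par i) (par i) 0).
have dB := is_deriveB (is_derive_entry m h i i 0) (is_deriveM (is_deriveM di di) dV).
apply: (is_derive_eq dB).
rewrite fctE /contrast_form /slope (negbTE ir) !scale0r !add0r /GRing.scale/=.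
by field; rewrite gt_eqF.
Qed.

Lemma line_IG m h e : IG m -> IG h -> IG (e *: h + m).
Proof.
move=> [mT mE] [hT hE]; split=> [|a b ab]; first by rewrite linearD linearZ /= mT hT.
by rewrite !mxE mE// hE// mulr0 addr0.
Qed.

Lemma near_pivotal m h : pivotal m -> IG h ->
  \forall e \near (0 : R), pivotal (e *: h + m).
Proof.
move=> pm hI.
near=> e; split; first exact: line_IG pm.1 hI.
near: e; apply: filter_forall => i.
have [dp _] := is_derive_pivot h i pm.
have /derivable1_diffP/differentiable_continuous cp := dp.
apply: (cvgr_gt _ cp) => /=; rewrite scale0r add0r; exact: pm.2.
Unshelve. all: by end_near. Qed.

Lemma gradient_ln_delta m : pivotal m ->
  is_gradient (fun x => ln (delta r.+1 s x)) m (parameter_of_mean m).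
Proof.
move=> pm; split=> [|h hI]; first by apply: coordmx_ZG; exact: slope_root.
rewrite pairing_coordmx//; apply: is_derive_line.
have near_sum : \forall e \near (0 : R),
    \sum_i s 0 i * ln (pivot (e *: h + m) i) = ln (delta r.+1 s (e *: h + m)).
  by near=> e; rewrite ln_delta_pivot//; near: e; exact: near_pivotal.
apply: (near_eq_is_derive near_sum).
have -> : (fun e => \sum_i s 0 i * ln (pivot (e *: h + m) i)) =
    \sum_(i < n) (fun e : R => s 0 i *: ln (pivot (e *: h + m) i)).
  by apply/funext => e; rewrite fct_sumE.
apply: is_derive_sum => i.
have p0 : 0 < pivot (0 *: h + m) i by rewrite scale0r add0r; exact: pm.2.
have dl := @is_derive1_comp _ (@ln R) (fun e => pivot (e *: h + m) i) 0 _ _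
  (is_derive1_ln p0) (is_derive_pivot h i pm).
have := is_deriveZ (s 0 i) dl.
move=> dz; apply: (is_derive_eq dz); rewrite scale0r add0r.
by rewrite /GRing.scale/= mulrA.
Unshelve. all: by end_near. Qed.

End gradient.

Theorem theorem4 (R : realType) (n M : nat) (s : 'rV[R]_n)
    (hn : (1 <= n)%N) (hM : (1 <= M <= n)%N)
    (hs : forall i, (1 <= i <= n)%N -> i != M -> 1 / 2 < coef s i)
    (hsM : 0 < coef s M) :
  [/\ forall y, PG y -> is_wishart M s y (wishart M s y),
      set_bij (@PG R n) (@QG R n) (mean_map M s)
    & forall m, QG m ->
        is_gradient (fun x => ln (delta M s x)) m (inverse_mean_map M s m)].
Proof.
case: n s hn hM hs hsM => [s hn|n s _ /andP[M0 Mn]]; first by rewrite ltnn in hn.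
case: M M0 Mn => [M0|M _ Mn hs hsM]; first by rewrite ltnn in M0.
pose r : 'I_n.+1 := Ordinal Mn.
have sr : 0 < s 0 r by rewrite -coef_ord.
have si i : i != r -> 1 / 2 < s 0 i.
  move=> ir; rewrite -coef_ord; apply: hs; first by rewrite /= ltn_ord.
  by rewrite eqSS; apply: contra ir => /eqP ir; apply/eqP/val_inj.
have s0 i : 0 < s 0 i.
  by have [->//|/si] := eqVneq i r; lra.
have meanP y : PG y -> pivotal r (mean_map M.+1 s y) /\
    parameter_of_mean r s (mean_map M.+1 s y) = y.
  move=> /(PG_coordmx r)[D [t [D0 tr ->]]].
  have [pm pE sE] := mean_coordinates si sr D0 tr; split=> //.
  rewrite /parameter_of_mean; apply: eq_bigr => i _.
  rewrite pE /contrast sE; congr (_ *: _).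
  by field; rewrite !gt_eqF.
have paramP m : pivotal r m -> PG (parameter_of_mean r s m) /\
    mean_map M.+1 s (parameter_of_mean r s m) = m.
  move=> pm; have D0 i : 0 < s 0 i / pivot r m i by rewrite divr_gt0// pm.2.
  split; first exact: coordmx_PG (slope_root r m) D0.
  have [pm' pE sE] := mean_coordinates si sr D0 (slope_root r m).
  apply: (pivotal_inj pm' pm) => i; last exact: sE.
  by rewrite pE; field; rewrite !gt_eqF// pm.2.
have inj : {in @PG R n.+1 &, injective (mean_map M.+1 s)}.
  move=> y y'; rewrite !inE => /meanP[_ yE] /meanP[_ yE'] myy'.
  by rewrite -yE -yE' myy'.
split.
- move=> y /(PG_coordmx r)[D [t [D0 tr ->]]].
  exact: (wishartP si sr D0 tr).
- split=> [y /meanP[pm _]|//|m /(QG_pivotal r)/paramP[Pm mE]].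
    exact/(QG_pivotal r).
  by exists (parameter_of_mean r s m).
- move=> m /(QG_pivotal r) pm; have [Pm mE] := paramP _ pm.
  have -> : inverse_mean_map M.+1 s m = parameter_of_mean r s m.
    by rewrite /inverse_mean_map -{1}mE pinvKV// inE.
  exact: (gradient_ln_delta s pm).
Qed.
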